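(* Let $G$ be a finite group, let $N$ be a normal subgroup of $G$, and let $\varphi$ be an irreducible $2$-Brauer character of $N$. Then $\varphi$ lies under some self-dual irreducible $2$-Brauer character $\theta$ of $G$ (i.e. $\varphi$ is a constituent of $\theta{\downarrow_N}$ for some self-dual irreducible $2$-Brauer character $\theta$ of $G$) if and only if $\varphi$ is $G$-conjugate to its dual $\overline{\varphi}$. Moreover, if such a self-dual $\theta$ exists, it can be chosen so that $\varphi$ occurs with odd multiplicity in $\theta{\downarrow_N}$.
   Context: Fix a $2$-modular system $(K,R,F)$: $R$ is a complete discrete valuation ring with field of fractions $K$ of characteristic $0$ and residue field $F=R/J(R)$ of characteristic $2$; $K$ and $F$ are assumed to be splitting fields for all subgroups of $G$. The Brauer character of an $FG$-module is an $R$-valued class function on the $2$-regular (odd order) elements of $G$; the irreducible $2$-Brauer characters of $G$ are the Brauer characters of the irreducible $FG$-modules. The dual $\overline{\theta}$ of a Brauer character $\theta$ is $\overline{\theta}(g)=\theta(g^{-1})$, and $\theta$ is self-dual if $\theta=\overline{\theta}$. $\theta{\downarrow_N}$ denotes restriction to $N$. $G$ acts by conjugation on the irreducible Brauer characters of its normal subgroup $N$. *)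

(* Defs.v *)
From HB Require Import structures.
From mathcomp Require Import all_boot all_order all_algebra all_fingroup.
From mathcomp Require Import mxrepresentation.

Set Implicit Arguments.
Unset Strict Implicit.
Unset Printing Implicit Defensive.

Import GroupScope GRing.Theory.
Local Open Scope ring_scope.

(* R is a discrete valuation ring iff it has a uniformizer; the ideals of R
   are then 0 and the powers J(R)^n = pi^n R, and J(R) is the set of nonunits. *)
Definition uniformizer (R : idomainType) (pi : R) : Prop :=
  [/\ pi != 0, pi \isn't a GRing.unit &
      forall x : R, x != 0 ->
        exists (u : R) (n : nat), u \is a GRing.unit /\ x = u * pi ^+ n].

Definition adic_small (R : idomainType) (pi : R) (n : nat) (x : R) : Prop :=
  exists y : R, x = pi ^+ n * y.

Definition adic_cauchy (R : idomainType) (pi : R) (u : nat -> R) : Prop :=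
  forall n : nat, exists m : nat,
    forall i j : nat, (m <= i)%N -> (m <= j)%N -> adic_small pi n (u i - u j).

Definition adic_limit (R : idomainType) (pi : R) (u : nat -> R) (l : R) : Prop :=
  forall n : nat, exists m : nat,
    forall i : nat, (m <= i)%N -> adic_small pi n (u i - l).

Definition complete_dvr (R : idomainType) : Prop :=
  exists2 pi : R, uniformizer pi &
    forall u : nat -> R, adic_cauchy pi u -> exists l : R, adic_limit pi u l.

(* [iota] exhibits K as the field of fractions of R, and [red] exhibits F as
   the residue field R / J(R). *)
Record modular_system (p : nat) (R : idomainType) (K F : fieldType)
    (iota : {rmorphism R -> K}) (red : {rmorphism R -> F}) : Prop :=
  ModularSystem {
    ms_complete_dvr : complete_dvr R;
    ms_frac_inj : injective iota;
    ms_frac : forall z : K, exists x y : R, y != 0 /\ z = iota x / iota y;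
    ms_red_surj : forall a : F, exists x : R, red x = a;
    ms_red_ker : forall x : R, (red x == 0) = (x \isn't a GRing.unit);
    ms_char0 : [pchar K] =i pred0;
    ms_charp : p \in [pchar F]
  }.

Definition splitting_for_subgroups (F : fieldType) (gT : finGroupType)
    (G : {group gT}) : Prop :=
  forall H : {group gT}, H \subset G -> group_splitting_field F H.

(* A function on the 2-regular elements of G is encoded as a finite function
   on gT that vanishes outside the set of 2-regular elements of G, so that two
   such functions agree on these elements iff they are equal. *)

Definition two_regular (gT : finGroupType) (G : {group gT}) : {set gT} :=
  [set g in G | odd #[g]].

(* For g of odd order, the eigenvalues of rG g are #[g]-th roots of unity of F;
   as #[g] is prime to char F each of them lifts uniquely to a #[g]-th root of
   unity of R, so the list s below is unique up to permutation. *)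
Definition is_brauer_character (R : idomainType) (F : fieldType)
    (red : {rmorphism R -> F}) (gT : finGroupType) (G : {group gT}) (n : nat)
    (rG : mx_representation F G n) (theta : {ffun gT -> R}) : Prop :=
  (forall g : gT, g \in two_regular G ->
     exists s : seq R,
       [/\ all (#[g].-unity_root) s,
           char_poly (rG g) = \prod_(z <- s) ('X - (red z)%:P) &
           theta g = \sum_(z <- s) z]) /\
  (forall g : gT, g \notin two_regular G -> theta g = 0).

Definition irr_brauer (R : idomainType) (F : fieldType)
    (red : {rmorphism R -> F}) (gT : finGroupType) (G : {group gT})
    (theta : {ffun gT -> R}) : Prop :=
  exists (n : nat) (rG : mx_representation F G n),
    mx_irreducible rG /\ is_brauer_character red rG theta.

Definition brauer_dual (R : idomainType) (gT : finGroupType)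
    (theta : {ffun gT -> R}) : {ffun gT -> R} :=
  [ffun g => theta (g^-1)%g].

Definition brauer_conj (R : idomainType) (gT : finGroupType) (x : gT)
    (theta : {ffun gT -> R}) : {ffun gT -> R} :=
  [ffun g => theta (x * g * x^-1)%g].

Definition brauer_res (R : idomainType) (gT : finGroupType) (N : {group gT})
    (theta : {ffun gT -> R}) : {ffun gT -> R} :=
  [ffun g => if g \in N then theta g else 0].

(* The list s of irreducible constituents of psi is unique up to permutation,
   as the irreducible Brauer characters of N are linearly independent. *)
Definition brauer_multiplicity (R : idomainType) (F : fieldType)
    (red : {rmorphism R -> F}) (gT : finGroupType) (N : {group gT})
    (phi psi : {ffun gT -> R}) (m : nat) : Prop :=
  exists s : seq {ffun gT -> R},
    [/\ forall chi : {ffun gT -> R}, chi \in s -> irr_brauer red N chi,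
        psi = \sum_(chi <- s) chi &
        count_mem phi s = m].

Definition brauer_constituent (R : idomainType) (F : fieldType)
    (red : {rmorphism R -> F}) (gT : finGroupType) (N : {group gT})
    (phi psi : {ffun gT -> R}) : Prop :=
  exists2 m : nat, (0 < m)%N & brauer_multiplicity red N phi psi m.

(* Main.v *)
Require Import Defs.
From HB Require Import structures.
From mathcomp Require Import all_boot all_order all_algebra all_fingroup.
From mathcomp Require Import mxrepresentation.
From mathcomp Require Import pgroup separable cyclotomic character.
From Stdlib Require Import Classical_Prop.

Set Implicit Arguments.
Unset Strict Implicit.
Unset Printing Implicit Defensive.

Import GroupScope GRing.Theory.
Local Open Scope ring_scope.

(** If [theta] is self-dual and lies over [phi], then by Clifford's theorem both
    [phi] and its dual are [G]-conjugate to one constituent of the restriction of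
    [theta] to [N].

    For the converse reduce everything modulo the maximal ideal. The reduction
    of a Brauer character, extended to [G] through [g |-> g_(2')], is the trace
    function of the module, and the trace functions of the irreducible modules
    are linearly independent over [F]. Let [t] be the trace function of [phi],
    extended by zero, and let [f g] be the sum of [u g_(2')] over the [G]-orbit of
    [t]. Then [f] is a class function with [f (g^2) = (f g)^2], and
    [f (g^-1) = f g] since the dual of [t] is in the orbit. The linear extension
    of [f] to the group algebra satisfies [f (a * a) = (f a)^2], as [f] is
    symmetric and [char F = 2]; so it kills nilpotent elements, hence the
    radical, and [f] is a combination of the irreducible trace functions [theta]
    of [G] with coefficients [c_theta]. Let [m_theta] be the coefficient of [t] in
    the restriction of [theta] to [N]. Both [c_theta] and [m_theta] are unchanged
    when [theta] is replaced by its dual, while the sum of [c_theta * m_theta] is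
    the coefficient 1 of [t] in the restriction of [f]. Pairs of mutually dual
    [theta] cancel in characteristic 2, so [m_theta <> 0] for some self-dual
    [theta], which means that [phi] has odd multiplicity in it. *)

(** * Irreducible trace functions *)

(** The two members of an orbit [{i, s i}] of length 2 contribute [f i + f i = 0], so only the fixed
    points of [s] remain. *)
Lemma sum_involution_pchar2 (V : zmodType) (I : eqType) (r : seq I)
    (s : I -> I) (f : I -> V) :
    (forall v : V, v + v = 0) -> uniq r ->
    {in r, forall i, s i \in r} -> {in r, involutive s} ->
    {in r, forall i, f (s i) = f i} ->
  \sum_(i <- r) f i = \sum_(i <- r | s i == i) f i.
Proof.
move=> ch2 Ur rs sK fs.
(* [p] picks from each orbit of length 2 the member that comes first in [r]; [s] exchanges the two
   halves. *)
pose p i := (index i r < index (s i) r)%N.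
rewrite (bigID (fun i => s i == i)) /= (bigID p (fun i => s i != i)) /=.
suff ->: \sum_(i <- r | (s i != i) && ~~ p i) f i
          = \sum_(i <- r | (s i != i) && p i) f i by rewrite ch2 addr0.
have permr : perm_eq [seq s i | i <- r] r.
  have inj_s: {in r &, injective s} by apply: can_in_inj sK.
  apply: uniq_perm => [||i] //; first by rewrite map_inj_in_uniq.
  apply/mapP/idP=> [[j rj ->]|ri]; first exact: rs.
  by exists (s i); rewrite ?rs ?sK.
rewrite -(perm_big _ permr) big_map [LHS]big_seq_cond [RHS]big_seq_cond.
apply: eq_big => [i|i /andP[ri _]]; last by rewrite fs.
have [ri /=|//] := boolP (i \in r); rewrite sK // [i == _]eq_sym.
have [//|nsi /=] := eqVneq; rewrite /p sK // -leqNgt leq_eqVlt.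
case: eqVneq => [eqi|//]; case/eqP: nsi.
by rewrite -[RHS](nth_index i ri) eqi nth_index ?rs.
Qed.

(** The swap [(i, j) |-> (j, i)] cancels everything off the diagonal. *)
Lemma sum_symmetric_pchar2 (V : zmodType) (I : finType) (P : pred I)
    (f : I -> I -> V) :
    (forall v : V, v + v = 0) -> {in P &, forall i j, f i j = f j i} ->
  \sum_(i | P i) \sum_(j | P j) f i j = \sum_(i | P i) f i i.
Proof.
move=> ch2 fC; rewrite pair_big big_mkcond /=.
rewrite (@sum_involution_pchar2 _ _ _ (fun p => (p.2, p.1))) //=; first last.
- move=> [i j] _ /=; rewrite andbC; case: ifP => // /andP[Pi Pj].
  exact: fC.
- by case.
- by move=> p _; rewrite mem_index_enum.
- exact: index_enum_uniq.
rewrite (reindex_onto (fun i => (i, i)) fst) => [|[i j] /eqP[->]] //.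
rewrite [RHS]big_mkcond /=; apply: eq_big => [i|i _]; first by rewrite !eqxx.
by rewrite andbb.
Qed.

(** The double sum of [A i j * A j i] is symmetric, so what is left is the sum of the [A i i ^+ 2],
    and squaring is additive. *)
Lemma mxtrace_sqr_pchar2 (F : fieldType) n (A : 'M[F]_n) :
  (2 \in [pchar F])%N -> \tr (A *m A) = \tr A ^+ 2.
Proof.
move=> ch2; rewrite /mxtrace -(pFrobenius_autE ch2) rmorph_sum /=.
under eq_bigr => i _ do rewrite mxE.
rewrite sum_symmetric_pchar2 => [|a|i j _ _]; last by rewrite mulrC.
  by apply: eq_bigr => i _; rewrite pFrobenius_autE expr2.
exact: addrr_pchar2.
Qed.

Lemma mul_delta_mx_delta (R : comPzRingType) m n p q (i : 'I_m) (j : 'I_n)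
    (A : 'M[R]_(n, p)) (k : 'I_p) (l : 'I_q) :
  delta_mx i j *m A *m delta_mx k l = A j k *: delta_mx i l.
Proof.
rewrite -(mul_delta_mx (0 : 'I_1) i j) -(mul_delta_mx (0 : 'I_1) k l).
rewrite !mulmxA -(mulmxA (delta_mx i 0) _ A) -rowE -(mulmxA (delta_mx i 0)) -colE.
rewrite [col k _]mx11_scalar mul_mx_scalar -scalemxAl mul_delta_mx.
by rewrite !mxE.
Qed.

(** Writing [e_ij = e_(i,i0) e_(i0,j)] and swapping the factors gives [h e_ij = 0] for [i != j] and
    the common value [h e_(i0,i0)] on the diagonal. *)
Lemma trace_like_mxtrace (F : fieldType) n (h : 'M[F]_n -> F) (i0 : 'I_n) :
    (forall A B, h (A + B) = h A + h B) -> (forall a A, h (a *: A) = a * h A) ->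
    (forall A B, h (A *m B) = h (B *m A)) ->
  forall A, h A = h (delta_mx i0 i0) * \tr A.
Proof.
move=> hD hZ hC A; have h0 : h 0 = 0 by rewrite -[0 in LHS](scale0r 0) hZ mul0r.
have hE i j : h (delta_mx i j) = h (delta_mx i0 i0) *+ (i == j).
  rewrite -(mul_delta_mx i0) hC mul_delta_mx_cond eq_sym.
  by case: eqP => //; rewrite mulr1n.
rewrite {1}[A]matrix_sum_delta (big_morph h hD h0) mulr_sumr.
apply: eq_bigr => i _; rewrite (big_morph h hD h0) (bigD1 i) //= big1 => [|j ne_j].
  by rewrite hZ hE eqxx mulr1n addr0 mulrC.
by rewrite hZ hE eq_sym (negPf ne_j) mulr0.
Qed.

(** * The group algebra, encoded by the regular representation *)

Section GroupRing.
Variables (F : fieldType) (gT : finGroupType) (G : {group gT}).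
Local Notation nG := #|pred_of_set (gval G)|.
Local Notation aG := (regular_repr F G).
Local Notation R_G := (group_ring F G).

(** An element of the group algebra is determined by the image of 1 under multiplication by it,
    which is the row that [gring_row] extracts. *)
Definition gring_coef (A : 'M[F]_nG) (x : gT) : F :=
  gring_row A 0 (gring_index G x).

Lemma gring_op_sum n (rG : mx_representation F G n) (A : 'M[F]_nG) :
  gring_op rG A = \sum_(x in G) gring_coef A x *: rG x.
Proof.
rewrite gring_opE /gring_mx /= mulmx_sum_row linear_sum /=.
rewrite (reindex (@enum_val gT G)) /=; last first.
  exact: (enum_val_bij_in (group1 G)).
apply: eq_big => [i|i _]; first by rewrite enum_valP.
by rewrite linearZ /= rowK mxvecK /gring_coef gring_valK.
Qed.

Lemma gring_mem_sum (a : gT -> F) : (\sum_(x in G) a x *: aG x \in R_G)%MS.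
Proof. by apply/envelop_mxP; exists a. Qed.

Lemma gring_op_bigsum n (rG : mx_representation F G n) (I : finType)
    (A : I -> 'M[F]_nG) :
  gring_op rG (\sum_i A i) = \sum_i gring_op rG (A i).
Proof. exact: linear_sum. Qed.

Lemma gring_op_scale n (rG : mx_representation F G n) a (A : 'M[F]_nG) :
  gring_op rG (a *: A) = a *: gring_op rG A.
Proof. exact: linearZ. Qed.

Lemma gring_opB n (rG : mx_representation F G n) (A B : 'M[F]_nG) :
  gring_op rG (A - B) = gring_op rG A - gring_op rG B.
Proof. exact: linearB. Qed.

Lemma gring_memB (A B : 'M[F]_nG) :
  (A \in R_G)%MS -> (B \in R_G)%MS -> (A - B \in R_G)%MS.
Proof. by move=> RA RB; rewrite linearB /= addmx_sub // eqmx_opp. Qed.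

Lemma gring_mem_bigsum (I : finType) (A : I -> 'M[F]_nG) :
  (forall i, (A i \in R_G)%MS) -> (\sum_i A i \in R_G)%MS.
Proof. by move=> RA; rewrite linear_sum /= summx_sub. Qed.

Lemma gring_mem_scale a (A : 'M[F]_nG) :
  (A \in R_G)%MS -> (a *: A \in R_G)%MS.
Proof. by move=> RA; rewrite linearZ /= scalemx_sub. Qed.

Lemma gring_op_lincomb n (rG : mx_representation F G n) (a : gT -> F) :
  gring_op rG (\sum_(x in G) a x *: aG x) = \sum_(x in G) a x *: rG x.
Proof.
rewrite linear_sum; apply: eq_bigr => x Gx.
by rewrite linearZ /= gring_opG.
Qed.

Lemma gring_sum_coef (A : 'M[F]_nG) :
  (A \in R_G)%MS -> A = \sum_(x in G) gring_coef A x *: aG x.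
Proof. by move=> RA; rewrite -gring_op_sum gring_op_id. Qed.

Lemma mxtrace_gring_op n (rG : mx_representation F G n) (A : 'M[F]_nG) :
  \tr (gring_op rG A) = \sum_(x in G) gring_coef A x * \tr (rG x).
Proof.
by rewrite gring_op_sum linear_sum; apply: eq_bigr => x _; rewrite linearZ.
Qed.

(** Absolute irreducibility means that the matrices [rG x] span the full matrix algebra. The section
    is only a choice of preimages; no linearity is asserted. *)
Lemma abs_irr_gring_op_section n (rG : mx_representation F G n) :
    mx_absolutely_irreducible rG ->
  exists s : 'M_n -> 'M_nG, forall B, (s B \in R_G)%MS /\ gring_op rG (s B) = B.
Proof.
case/mx_abs_irrP=> _ [a aE].
exists (fun B => \sum_(x in G) a x B *: aG x) => B; split.
  exact: (gring_mem_sum (a^~ B)).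
by rewrite (gring_op_lincomb rG (a^~ B)) -aE.
Qed.

Lemma abs_irr_gring_op_onto n (rG : mx_representation F G n) (B : 'M_n) :
    mx_absolutely_irreducible rG ->
  exists2 A, (A \in R_G)%MS & gring_op rG A = B.
Proof. by case/abs_irr_gring_op_section=> s /(_ B)[]; exists (s B). Qed.

(* If the kernel of r2 is contained in that of r1, then sending the j-th basis
   vector to v r1(C j), where r2(C j) is the elementary matrix e_(i0,j),
   defines a nonzero module morphism. *)
Lemma gring_ker_sub_rsim n1 n2 (r1 : mx_representation F G n1)
    (r2 : mx_representation F G n2) :
    mx_absolutely_irreducible r1 -> mx_absolutely_irreducible r2 ->
    (forall A, (A \in R_G)%MS -> gring_op r2 A = 0 -> gring_op r1 A = 0) ->
  mx_rsim r1 r2.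
Proof.
move=> abs1 abs2 ker21; have irr1 := mx_abs_irrW abs1.
have irr2 := mx_abs_irrW abs2.
have [n1_gt0 _] := (mx_irrP r1).1 irr1; have [n2_gt0 minr2] := (mx_irrP r2).1 irr2.
have eq21 A B: (A \in R_G)%MS -> (B \in R_G)%MS ->
  gring_op r2 A = gring_op r2 B -> gring_op r1 A = gring_op r1 B.
- move=> RA RB eqAB; apply/eqP.
  by rewrite -subr_eq0 -gring_opB ker21 ?gring_memB // gring_opB eqAB subrr.
pose i0 := Ordinal n2_gt0.
have onto2 B := abs_irr_gring_op_onto B abs2.
have /fin_all_exists2[C RC r2C] := fun j => onto2 (delta_mx i0 j).
have /fin_all_exists2[D RD r2D] := fun j => onto2 (delta_mx j i0).
(* Otherwise the sum of the [D j *m C i0 *m C j], which [r2] maps to the sum of the [e_jj], that is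
   to 1, would act as 0 under [r1], while by [eq21] it acts as 1. *)
have [k v_nz] : exists k, row k (gring_op r1 (C i0)) != 0.
  apply/existsP; apply: contraTT n1_gt0; rewrite negb_exists -leqNgt => /forallP r0.
  have r1C0 : gring_op r1 (C i0) = 0.
    by apply/row_matrixP=> i; rewrite row0; apply/eqP; rewrite -[_ == _]negbK.
  have := eq21 1%:M (\sum_j D j *m C i0 *m C j) (envelop_mx1 _).
  rewrite gring_op1 !gring_op_bigsum.
  rewrite (eq_bigr (fun j => delta_mx j j)) => [|j _]; last first.
    by rewrite !gring_opM ?r2C ?r2D // !mul_delta_mx.
  have R0 : (\sum_j D j *m C i0 *m C j \in R_G)%MS.
    by apply: gring_mem_bigsum => j; rewrite !envelop_mxM.
  rewrite -mx1_sum_delta => /(_ R0 erefl); rewrite gring_op1 big1 => [|j _].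
    by move/(congr1 mxrank); rewrite mxrank1 mxrank0 => ->; exact: leqnn.
  by rewrite !gring_opM // r1C0 mulmx0 mul0mx.
pose v := row k (gring_op r1 (C i0)); rewrite -/v in v_nz.
pose phi := \matrix_j (v *m gring_op r1 (C j)).
have hom_phi x : x \in G -> r2 x *m phi = phi *m r1 x.
  move=> Gx; apply/row_matrixP=> j; rewrite !row_mul rowK.
  have Rx : (aG x \in R_G)%MS by apply: envelop_mx_id.
  rewrite -mulmxA -[r1 x](gring_opG r1) // -gring_opM //.
  (* Under [r2] both elements are [e_(i0,j) r2(x)], the second one expanded along row [j] of
     [r2 x]. *)
  rewrite (@eq21 (C j *m aG x) (\sum_l r2 x j l *: C l)); first last.
  - rewrite gring_opM // gring_opG // r2C gring_op_bigsum.
    rewrite -(mul_delta_mx (0 : 'I_1) i0 j) -mulmxA -rowE.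
    rewrite [row j _]row_sum_delta mulmx_sumr; apply: eq_bigr => l _.
    by rewrite gring_op_scale r2C -scalemxAr mul_delta_mx mxE.
  - by apply: gring_mem_bigsum => l; apply: gring_mem_scale.
  - by rewrite envelop_mxM.
  rewrite gring_op_bigsum mulmx_sumr mulmx_sum_row; apply: eq_bigr => l _.
  by rewrite gring_op_scale -scalemxAr rowK mxE.
have phi_nz : phi != 0.
  apply: contraNneq v_nz => phi0.
  have : row i0 phi = v.
    rewrite rowK /v -row_mul -gring_opM // (@eq21 _ (C i0)) ?envelop_mxM //.
    by rewrite gring_opM // r2C mul_delta_mx.
  by rewrite phi0 row0 => <-.
apply: mx_rsim_sym.
(* Schur's lemma: the kernel of [phi] is a submodule of [r2], its image one of [r1]. *)
have free_phi : row_free phi.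
  rewrite -kermx_eq0; apply: contraNT phi_nz => kphi_nz.
  have /(minr2 _)/(_ kphi_nz) : mxmodule r2 (kermx phi).
    apply/mxmoduleP=> x Gx; apply/sub_kermxP.
    by rewrite -mulmxA hom_phi // mulmxA mulmx_ker mul0mx.
  by rewrite -sub1mx => /sub_kermxP; rewrite mul1mx => ->.
have full_phi : row_full phi.
  have := (mx_irrP r1).1 irr1 => -[_ /(_ <<phi>>%MS)].
  rewrite (eqmx_module _ (genmxE _)) (eqmx_eq0 (genmxE _)) phi_nz /row_full genmxE.
  apply=> //; apply/mxmoduleP=> x Gx; rewrite -hom_phi //; exact: submxMl.
exists phi => //.
by move: free_phi full_phi => /eqP rk2 /eqP rk1; rewrite -[LHS]rk2.
Qed.

Lemma gring_op_rsim n1 n2 (r1 : mx_representation F G n1)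
    (r2 : mx_representation F G n2) A :
  mx_rsim r1 r2 -> gring_op r1 A = 0 -> gring_op r2 A = 0.
Proof.
case/mx_rsim_sym/mx_rsim_def=> B [B' _ homB] r1A0.
rewrite gring_op_sum (eq_bigr (fun x => B *m (gring_coef A x *: r1 x) *m B')).
  by rewrite -mulmx_suml -mulmx_sumr -gring_op_sum r1A0 mulmx0 mul0mx.
by move=> x Gx; rewrite homB // -scalemxAr -scalemxAl.
Qed.

(** * Trace functions and linear functionals on the group algebra *)

Definition repr_trace n (rG : mx_representation F G n) : {ffun gT -> F} :=
  [ffun x => if x \in G then \tr (rG x) else 0].

Definition irr_trace (t : {ffun gT -> F}) : Prop :=
  exists (n : nat) (rG : mx_representation F G n),
    mx_irreducible rG /\ t = repr_trace rG.

Lemma repr_traceE n (rG : mx_representation F G n) x :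
  x \in G -> repr_trace rG x = \tr (rG x).
Proof. by move=> Gx; rewrite ffunE Gx. Qed.

Lemma repr_trace_rsim n1 n2 (r1 : mx_representation F G n1)
    (r2 : mx_representation F G n2) :
  mx_rsim r1 r2 -> repr_trace r1 = repr_trace r2.
Proof.
move=> sim12; apply/ffunP=> x; rewrite !ffunE.
by case: ifP => // Gx; apply: mxtrace_rsim.
Qed.

(* The linear extension of [f] to the group algebra, whose elements are encoded
   as matrices of the regular representation. *)
Definition gring_fun (f : gT -> F) (A : 'M[F]_nG) : F :=
  \sum_(x in G) gring_coef A x * f x.

Lemma gring_fun_trace n (rG : mx_representation F G n) A :
  gring_fun (repr_trace rG) A = \tr (gring_op rG A).
Proof.
rewrite mxtrace_gring_op; apply: eq_bigr => x Gx.
by rewrite repr_traceE.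
Qed.

Lemma gring_coef_reg x y : x \in G -> y \in G -> gring_coef (aG x) y = (x == y)%:R.
Proof.
move=> Gx Gy; rewrite /gring_coef /gring_row mxE /regular_mx mxE.
rewrite gring_indexK // mul1g mxE eqxx /=.
by rewrite (can_in_eq (@gring_indexK _ G)) // eq_sym.
Qed.

Lemma gring_funD f A B : gring_fun f (A + B) = gring_fun f A + gring_fun f B.
Proof.
rewrite -big_split; apply: eq_bigr => x _ /=.
by rewrite /gring_coef linearD mxE mulrDl.
Qed.

Lemma gring_funZ f a A : gring_fun f (a *: A) = a * gring_fun f A.
Proof.
rewrite mulr_sumr; apply: eq_bigr => x _.
by rewrite /gring_coef linearZ mxE mulrA.
Qed.

Lemma gring_fun0 f : gring_fun f 0 = 0.
Proof. by rewrite -[0 in LHS](scale0r 0) gring_funZ mul0r. Qed.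

Lemma gring_funB f A B : gring_fun f (A - B) = gring_fun f A - gring_fun f B.
Proof. by rewrite gring_funD -scaleN1r gring_funZ mulN1r. Qed.

Lemma gring_fun_sum f (I : Type) (r : seq I) (P : pred I) (A : I -> 'M[F]_nG) :
  gring_fun f (\sum_(i <- r | P i) A i) = \sum_(i <- r | P i) gring_fun f (A i).
Proof. exact: (big_morph _ (gring_funD f) (gring_fun0 f)). Qed.

Lemma gring_fun_reg f x : x \in G -> gring_fun f (aG x) = f x.
Proof.
move=> Gx; rewrite /gring_fun (bigD1 x) //= big1 => [|y /andP[Gy ne_yx]].
  by rewrite gring_coef_reg // eqxx mul1r addr0.
by rewrite gring_coef_reg // eq_sym (negPf ne_yx) mul0r.
Qed.

Lemma gring_funM f A B : (A \in R_G)%MS -> (B \in R_G)%MS ->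
  gring_fun f (A *m B) =
    \sum_(x in G) \sum_(y in G) gring_coef A x * gring_coef B y * f (x * y)%g.
Proof.
move=> RA RB; rewrite {1}(gring_sum_coef RA) {1}(gring_sum_coef RB).
rewrite mulmx_suml gring_fun_sum; apply: eq_bigr => x Gx.
rewrite mulmx_sumr gring_fun_sum; apply: eq_bigr => y Gy.
rewrite -scalemxAl -scalemxAr !gring_funZ mulrA -repr_mxM //.
by rewrite gring_fun_reg ?groupM.
Qed.

Lemma gring_funC f : {in G &, forall x y, f (x * y)%g = f (y * x)%g} ->
  forall A B, (A \in R_G)%MS -> (B \in R_G)%MS ->
  gring_fun f (A *m B) = gring_fun f (B *m A).
Proof.
move=> fC A B RA RB; rewrite !gring_funM // exchange_big.
apply: eq_bigr => x Gx; apply: eq_bigr => y Gy.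
by rewrite fC // [_ * gring_coef B _]mulrC.
Qed.

(** The terms for [(x, y)] and [(y, x)] agree and cancel; the diagonal gives
    [a_x^2 f (x^2) = (a_x f x)^2], and squaring is additive. *)
Lemma gring_fun_sqr f : (2 \in [pchar F])%N ->
    {in G &, forall x y, f (x * y)%g = f (y * x)%g} ->
    {in G, forall x, f (x * x)%g = f x ^+ 2} ->
  forall A, (A \in R_G)%MS -> gring_fun f (A *m A) = gring_fun f A ^+ 2.
Proof.
move=> ch2 fC f2 A RA; rewrite gring_funM //.
rewrite sum_symmetric_pchar2 => [|a|x y Gx Gy]; last first.
- by rewrite fC // [gring_coef A x * _]mulrC.
- exact: addrr_pchar2.
rewrite -(pFrobenius_autE ch2) rmorph_sum /=; apply: eq_bigr => x Gx.
by rewrite pFrobenius_autE f2 // exprMn expr2.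
Qed.

Lemma factmod_gring_op n (rG : mx_representation F G n) (U : 'M_n)
    (modU : mxmodule rG U) m (W : 'M_(m, n)) A :
  in_factmod U (W *m gring_op rG A) = in_factmod U W *m gring_op (factmod_repr modU) A.
Proof.
rewrite !gring_op_sum !mulmx_sumr linear_sum; apply: eq_bigr => x Gx.
by rewrite -!scalemxAr linearZ /= -in_factmodJ.
Qed.

Lemma submod_gring_op0 n (rG : mx_representation F G n) (U : 'M_n)
    (modU : mxmodule rG U) m (W : 'M_(m, n)) A :
  gring_op (submod_repr modU) A = 0 -> (W <= U)%MS -> W *m gring_op rG A = 0.
Proof.
move=> A0; rewrite -(val_submod1 U) => /submxP[D ->]; rewrite -mulmxA.
suff -> : @val_submod _ _ U _ 1%:M *m gring_op rG A = 0 by rewrite mulmx0.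
transitivity (@val_submod _ _ U _ (1%:M *m gring_op (submod_repr modU) A)).
  rewrite !gring_op_sum !mulmx_sumr [RHS]linear_sum; apply: eq_bigr => x Gx.
  by rewrite -!scalemxAr linearZ /= -val_submodJ.
by rewrite A0 mulmx0 linear0.
Qed.

(** Existence of simple submodules and of composition series over an arbitrary field is stated under
    [classically]; excluded middle removes it. *)
Lemma classically_elim (P : Prop) : classically P -> P.
Proof.
move=> cP; apply: NNPP => nP.
by have := cP false (fun p => False_ind _ (nP p)).
Qed.

(** Induction on the dimension: the element kills a simple submodule [U] and is nilpotent on the
    quotient by [U]. *)
Lemma gring_op_nilpotent A :
    (forall m (r : mx_representation F G m), mx_irreducible r -> gring_op r A = 0) ->
  forall n (rG : mx_representation F G n), exists k, gring_op rG A ^+ k = 0.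
Proof.
move=> irrA n; elim/ltn_ind: n => -[|n] IHn rG.
  by exists 0; apply: flatmx0.
have nz1 : 1%:M != 0 :> 'M[F]_n.+1 by rewrite -mxrank_eq0 mxrank1.
have [U simU _] := classically_elim (mxsimple_exists (mxmodule1 rG) nz1).
have [modU nzU _] := simU.
have A0 : gring_op (submod_repr modU) A = 0 by apply/irrA/submod_mx_irr.
have ltn : (\rank (cokermx U) < n.+1)%N.
  by rewrite mxrank_coker ltn_subrL lt0n mxrank_eq0 nzU.
have [k facA] := IHn _ ltn (factmod_repr modU).
(* The power [k] maps into [U], where one more factor gives zero. *)
exists k.+1; rewrite exprSr -mulmxE (submod_gring_op0 A0) //.
rewrite -in_factmod_eq0.
have -> : in_factmod U (gring_op rG A ^+ k) =
    in_factmod U 1 *m gring_op (factmod_repr modU) A ^+ k.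
  elim: (k) => [|j IHj]; first by rewrite !expr0 mulmx1.
  by rewrite !exprSr -!mulmxE factmod_gring_op IHj mulmxA.
by rewrite facA mulmx0.
Qed.

(** Every irreducible module is isomorphic to a factor of one fixed composition series of the
    regular module. *)
Lemma irr_trace_enum : exists L : seq {ffun gT -> F},
  uniq L /\ forall t, irr_trace t <-> t \in L.
Proof.
have [V [compV lastV _]] := classically_elim (@mx_Schreier _ _ _ _ aG [::] isT isT).
pose L := [seq repr_trace (series_repr i compV) | i <- iota 0 (size V)].
exists (undup L); split=> [|t]; first exact: undup_uniq.
rewrite mem_undup; split=> [[n [rG [irrG ->]]] | /mapP[i]].
  have [i simGi] := rsim_regular_series irrG compV lastV.
  by rewrite (repr_trace_rsim simGi) map_f // mem_iota /=.
rewrite mem_iota /= add0n => ltiV ->.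
by exists _, (series_repr i compV); split=> //; apply: mx_series_repr_irr.
Qed.

(** * Irreducible modules and their traces over a splitting field *)

Section Splitting.
Hypothesis splitG : group_splitting_field F G.

(** The kernel of [r2] in the group algebra is not contained in that of [r1]; being an ideal, it is
    mapped by [r1] onto a nonzero ideal of a full matrix algebra, hence onto everything. *)
Lemma irr_separation n1 n2 (r1 : mx_representation F G n1)
    (r2 : mx_representation F G n2) :
    mx_irreducible r1 -> mx_irreducible r2 -> ~ mx_rsim r1 r2 ->
  exists2 A, (A \in R_G)%MS & gring_op r1 A = 1%:M /\ gring_op r2 A = 0.
Proof.
move=> /splitG abs1 /splitG abs2 nsim12.
have [A [RA r2A r1A]] : exists A,
  [/\ (A \in R_G)%MS, gring_op r2 A = 0 & gring_op r1 A <> 0].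
- apply: NNPP => noA; case: nsim12; apply: gring_ker_sub_rsim => // A RA r2A.
  by apply: NNPP => r1A; case: noA; exists A.
have [p [q Apq]] : exists p q, gring_op r1 A p q != 0.
  apply: NNPP => A0; apply: r1A; apply/matrixP=> p q; rewrite [RHS]mxE.
  by have [//|nz] := eqVneq (gring_op r1 A p q) 0; case: A0; exists p; exists q.
have onto1 B := abs_irr_gring_op_onto B abs1.
have /fin_all_exists2[C RC r1C] := fun i => onto1 (delta_mx i p).
have /fin_all_exists2[D RD r1D] := fun i => onto1 (delta_mx q i).
have RCAD i : (C i *m A *m D i \in R_G)%MS by rewrite !envelop_mxM.
(* [e_ip A e_qi = A_pq e_ii], and these sum to [A_pq] times the identity. *)
exists ((gring_op r1 A p q)^-1 *: \sum_i C i *m A *m D i).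
  by apply: gring_mem_scale; apply: gring_mem_bigsum.
rewrite !gring_op_scale !gring_op_bigsum; split; last first.
  rewrite big1 ?scaler0 // => i _.
  by rewrite !gring_opM ?envelop_mxM // r2A mulmx0 mul0mx.
rewrite (eq_bigr (fun i => gring_op r1 A p q *: delta_mx i i)) => [|i _].
  by rewrite -scaler_sumr -mx1_sum_delta scalerA mulVf // scale1r.
rewrite !gring_opM ?envelop_mxM // r1C r1D.
exact: mul_delta_mx_delta.
Qed.

Lemma irr_trace_rsim n1 n2 (r1 : mx_representation F G n1)
    (r2 : mx_representation F G n2) :
    mx_irreducible r1 -> mx_irreducible r2 -> repr_trace r1 = repr_trace r2 ->
  mx_rsim r1 r2.
Proof.
move=> irr1 irr2 eqtr; apply: NNPP => nsim12.
have [A RA [r1A r2A]] := irr_separation irr1 irr2 nsim12.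
have [n1_gt0 _] := (mx_irrP r1).1 irr1; pose i0 := Ordinal n1_gt0.
(* The identity matrix may have trace 0 in positive characteristic; the factor [B], acting on [r1]
   as [e_(i0,i0)], makes the trace 1. *)
have [B RB r1B] := abs_irr_gring_op_onto (delta_mx i0 i0) (splitG irr1).
have /eqP := congr1 (fun t => gring_fun (t : {ffun gT -> F}) (B *m A)) eqtr.
rewrite !gring_fun_trace !gring_opM // r1A r2A r1B mulmx0 mulmx1 mxtrace0.
rewrite /mxtrace (bigD1 i0) //= big1 => [|j ne_j]; rewrite mxE ?eqxx ?addr0.
  by rewrite oner_eq0.
by rewrite (negPf ne_j).
Qed.

(** Separating elements for the members of [L] are multiplied together one at a time; a member that
    is not an irreducible trace function, or is the trace of [rG] itself, adds no factor. *)
Lemma irr_trace_separation n (rG : mx_representation F G n)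
    (L : seq {ffun gT -> F}) :
    mx_irreducible rG ->
  exists2 A, (A \in R_G)%MS & gring_op rG A = 1%:M /\
    forall m (r : mx_representation F G m), mx_irreducible r ->
      repr_trace r \in L -> repr_trace r != repr_trace rG -> gring_op r A = 0.
Proof.
move=> irrG; elim: L => [|t L [A RA [rGA rA]]].
  by exists 1%:M; [exact: envelop_mx1 | split; first exact: gring_op1].
have [[n0 [r0 [irr0 def_t]]] | not_t] := classic (irr_trace t); last first.
  exists A => //; split=> // m r irr_r; rewrite inE => /orP[/eqP def_t|]; last first.
    exact: rA.
  by case: not_t; exists m, r.
have [eqtG | neqtG] := eqVneq t (repr_trace rG).
  exists A => //; split=> // m r irr_r; rewrite inE eqtG => /orP[->//|].
  exact: rA.
have [|B RB [rGB r0B]] := irr_separation irrG irr0.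
  by move/repr_trace_rsim => eqtr; case/eqP: neqtG; rewrite def_t.
exists (A *m B); first exact: envelop_mxM.
rewrite gring_opM // rGA rGB mulmx1; split=> // m r irr_r.
rewrite inE gring_opM // => /orP[/eqP eqrt _ | Lr neq_r].
  have sim0r := irr_trace_rsim irr0 irr_r (esym (etrans eqrt def_t)).
  by rewrite (gring_op_rsim sim0r r0B) mulmx0.
by rewrite rA // mul0mx.
Qed.

(** A separating element is multiplied by one acting as [e_(i0,i0)]. The functional [gring_fun _ A]
    then reads off the coefficient of [t] in a combination of irreducible traces from [L]. *)
Lemma irr_trace_dual_basis (L : seq {ffun gT -> F}) t :
    irr_trace t ->
  exists2 A, (A \in R_G)%MS & gring_fun t A = 1 /\
    forall u, u \in L -> irr_trace u -> u != t -> gring_fun u A = 0.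
Proof.
move=> [n [rG [irrG ->]]].
have [B RB [rGB rB]] := irr_trace_separation L irrG.
have [n_gt0 _] := (mx_irrP rG).1 irrG; pose i0 := Ordinal n_gt0.
have [C RC rGC] := abs_irr_gring_op_onto (delta_mx i0 i0) (splitG irrG).
exists (C *m B); first exact: envelop_mxM.
split=> [|u Lu [m [r [irr_r def_u]]] neq_u].
  rewrite gring_fun_trace gring_opM // rGB rGC mulmx1.
  rewrite /mxtrace (bigD1 i0) //= big1 => [|j ne_j]; rewrite mxE ?eqxx ?addr0 //.
  by rewrite (negPf ne_j).
rewrite def_u in Lu neq_u *.
by rewrite gring_fun_trace gring_opM // rB // mulmx0 mxtrace0.
Qed.

Lemma irr_trace_free (L : seq {ffun gT -> F}) (c : {ffun gT -> F} -> F) :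
    uniq L -> {in L, forall t, irr_trace t} ->
    {in G, forall x, \sum_(t <- L) c t * (t : {ffun gT -> F}) x = 0} ->
  {in L, forall t, c t = 0}.
Proof.
move=> uL irrL sum0 t Lt.
have [A _ [tA uA]] := irr_trace_dual_basis L (irrL t Lt).
have : \sum_(u <- L) c u * gring_fun u A = 0.
  under eq_bigr => u _ do rewrite mulr_sumr.
  rewrite exchange_big big1 //= => x Gx.
  under eq_bigr => u _ do rewrite mulrCA.
  by rewrite -mulr_sumr sum0 ?mulr0.
rewrite (bigD1_seq t) //= tA mulr1 big_seq_cond big1 ?addr0 // => u /andP[Lu neq].
by rewrite uA ?mulr0 //; apply: irrL.
Qed.

(** The squaring rule is iterated; powers of 2 are enough to reach a vanishing power of a nilpotent
    element. *)
Lemma gring_fun_expr2 f : (2 \in [pchar F])%N ->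
    {in G &, forall x y, f (x * y)%g = f (y * x)%g} ->
    {in G, forall x, f (x * x)%g = f x ^+ 2} ->
  forall A j, (A \in R_G)%MS ->
    (A ^+ (2 ^ j) \in R_G)%MS /\ gring_fun f (A ^+ (2 ^ j)) = gring_fun f A ^+ (2 ^ j).
Proof.
move=> ch2 fC f2 A j RA; elim: j => [|j [RAj fAj]]; first by rewrite !expn0 !expr1.
rewrite expnS mul2n -addnn !exprD -!mulmxE; split; first exact: envelop_mxM.
by rewrite gring_fun_sqr // fAj expr2.
Qed.

(** Modulo the radical the algebra is a product of full matrix algebras, and a central functional on
    each of these is a multiple of the trace. *)
Lemma class_fun_span f (L : seq {ffun gT -> F}) : (2 \in [pchar F])%N ->
    {in G &, forall x y, f (x * y)%g = f (y * x)%g} ->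
    {in G, forall x, f (x * x)%g = f x ^+ 2} ->
    uniq L -> (forall t, irr_trace t <-> t \in L) ->
  exists c : {ffun gT -> F} -> F,
    {in G, forall x, f x = \sum_(t <- L) c t * (t : {ffun gT -> F}) x}.
Proof.
move=> ch2 fC f2 uL irrL; pose t (i : 'I_(size L)) := nth 0 L i.
have Lt i : t i \in L by rewrite mem_nth.
have /fin_all_exists[R irrR] i : exists R : representation F G,
  mx_irreducible R /\ t i = repr_trace R.
- by have /irrL[n [r irr_r]] := Lt i; exists (Representation r).
have [irr_R tR] := all_and2 irrR.
(* [f] sees only the action on the irreducible modules: the difference [Z] of two elements with
   equal actions is nilpotent, so a power of [gring_fun f Z] is 0. *)
have eq_irr X Y : (X \in R_G)%MS -> (Y \in R_G)%MS ->
    (forall i, gring_op (R i) X = gring_op (R i) Y) -> gring_fun f X = gring_fun f Y.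
  move=> RX RY eqXY; apply/eqP; rewrite -subr_eq0 -gring_funB.
  have RZ := gring_memB RX RY; have killZ i : gring_op (R i) (X - Y) = 0.
    by rewrite gring_opB eqXY subrr.
  move: (X - Y) RZ killZ => {X Y RX RY eqXY} Z RZ killZ.
  have [m r irr_r | k] := @gring_op_nilpotent Z _ _ aG.
    have Lr : repr_trace r \in L by apply/irrL; exists m, r.
    have ltr : (index (repr_trace r) L < size L)%N by rewrite index_mem.
    apply: gring_op_rsim (killZ (Ordinal ltr)); apply: irr_trace_rsim => //.
    by rewrite -tR /t nth_index.
  rewrite gring_op_id // => Zk0; have [_ fZk] := gring_fun_expr2 ch2 fC f2 k RZ.
  have : gring_fun f Z ^+ (2 ^ k) == 0.
    (* As [k <= 2 ^ k], the power [Z ^+ (2 ^ k)] contains the factor [Z ^+ k = 0]. *)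
    by rewrite -fZk -(subnK (ltnW (ltn_expl k (ltnSn 1)))) exprD Zk0 mulr0 gring_fun0.
  by rewrite expf_eq0 expn_gt0 => /andP[_].
(* [P i] acts as 1 on [R i] and as 0 on the other irreducible modules: modulo the radical, a central
   idempotent. *)
have /fin_all_exists2[P RP opP] i := irr_trace_separation L (irr_R i).
have opPi i : gring_op (R i) (P i) = 1%:M by have [] := opP i.
have opPj i j : j != i -> gring_op (R j) (P i) = 0.
  move=> ne_ji; have [_ ->] := opP i => //; rewrite -!tR //.
  by rewrite /t nth_uniq.
have /fin_all_exists[c cE] i : exists c, forall X, (X \in R_G)%MS ->
    gring_fun f (X *m P i) = c * \tr (gring_op (R i) X).
  have [n_gt0 _] := (mx_irrP (R i)).1 (irr_R i).
  have [s sE] := abs_irr_gring_op_section (splitG (irr_R i)).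
  have [Rs op_s] := all_and2 sE.
  (* By [eq_irr], [gring_fun f (X *m P i)] depends only on the matrix of [X] on [R i]; this makes
     [h] linear and central, whatever preimages [s] chooses. *)
  pose h B := gring_fun f (s B *m P i).
  have hE X : (X \in R_G)%MS -> gring_fun f (X *m P i) = h (gring_op (R i) X).
    move=> RX; apply: eq_irr; rewrite ?envelop_mxM // => j.
    rewrite !gring_opM //; have [->|ne_ji] := eqVneq j i; first by rewrite op_s.
    by rewrite opPj // !mulmx0.
  exists (h (delta_mx (Ordinal n_gt0) (Ordinal n_gt0))) => X RX; rewrite hE //.
  apply: trace_like_mxtrace => {X RX}[A B|a A|A B].
  - rewrite -{1}(op_s A) -{1}(op_s B) -linearD -hE /=; last first.
      by rewrite linearD /= addmx_sub.
    by rewrite mulmxDl gring_funD.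
  - rewrite -{1}(op_s A) -gring_op_scale -hE; last exact: gring_mem_scale.
    by rewrite -scalemxAl gring_funZ.
  rewrite -{1}(op_s A) -{1}(op_s B) -gring_opM // -hE ?envelop_mxM //.
  rewrite -{2}(op_s A) -{2}(op_s B) -gring_opM // -hE ?envelop_mxM //.
  (* [X Y P_i] and [(X P_i)(Y P_i)] act alike on all irreducible modules, so the symmetry of [f]
     passes to [h]. *)
  have mP X Y : (X \in R_G)%MS -> (Y \in R_G)%MS ->
      gring_fun f (X *m Y *m P i) = gring_fun f ((X *m P i) *m (Y *m P i)).
    move=> RX RY; apply: eq_irr; rewrite ?envelop_mxM // => j.
    rewrite !gring_opM ?envelop_mxM //; have [->|ne_ji] := eqVneq j i.
      by rewrite opPi !mulmx1.
    by rewrite opPj // !mulmx0.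
  by rewrite !mP // gring_funC ?envelop_mxM.
exists (fun u => if insub (index u L) is Some i then c i else 0) => x Gx.
have Rx : (aG x \in R_G)%MS by apply: envelop_mx_id.
(* The sum of the [P i] acts as 1 on every irreducible module, so [f] does not distinguish [x] from
   the sum of the [x P_i]. *)
rewrite -(gring_fun_reg f Gx) (eq_irr _ (\sum_i aG x *m P i)) //; first last.
- move=> i; rewrite gring_op_bigsum (bigD1 i) //= big1 => [|j ne_ji].
    by rewrite gring_opM // opPi mulmx1 addr0.
  by rewrite gring_opM // opPj 1?eq_sym // mulmx0.
- by apply: gring_mem_bigsum => i; apply: envelop_mxM.
rewrite gring_fun_sum (big_nth 0) big_mkord; apply: eq_bigr => i _.
rewrite index_uniq // valK cE // gring_opG //.
by rewrite -/(t i) tR repr_traceE.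
Qed.

End Splitting.
End GroupRing.

(** * Brauer characters *)

Lemma mx_repr_trmx_inv (F : fieldType) (gT : finGroupType) (G : {group gT}) n
    (rG : mx_representation F G n) : mx_repr G (fun g => (rG g^-1%g)^T).
Proof.
split=> [|x y Gx Gy]; first by rewrite invg1 repr_mx1 trmx1.
by rewrite invMg repr_mxM ?groupV // trmx_mul.
Qed.

Definition dual_repr (F : fieldType) (gT : finGroupType) (G : {group gT}) n
    (rG : mx_representation F G n) := MxRepresentation (mx_repr_trmx_inv rG).

(** Transposing the matrices and inverting the group elements keeps a spanning set of the matrix
    algebra spanning. *)
Lemma dual_repr_abs_irr (F : fieldType) (gT : finGroupType) (G : {group gT}) n
    (rG : mx_representation F G n) :
  mx_absolutely_irreducible rG -> mx_absolutely_irreducible (dual_repr rG).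
Proof.
case/mx_abs_irrP=> n_gt0 [a aE]; apply/mx_abs_irrP; split=> //.
exists (fun x A => a x^-1%g A^T) => A; rewrite -[LHS]trmxK {1}[A^T]aE linear_sum.
rewrite (reindex_inj invg_inj) /=; apply: eq_big => [x|x Gx]; first exact: groupV.
by rewrite linearZ.
Qed.

Lemma mx_repr_conj (F : fieldType) (gT : finGroupType) (N : {group gT}) n
    (rN : mx_representation F N n) (x : gT) (nNx : x \in 'N(N)) :
  mx_repr N (fun g => rN (g ^ x^-1)%g).
Proof.
split=> [|g h Ng Nh]; first by rewrite conj1g repr_mx1.
by rewrite conjMg repr_mxM ?memJ_norm ?groupV.
Qed.

(** The exponent [x^-1] matches [brauer_conj], since [x * g * x^-1 = g ^ x^-1]. *)
Definition conj_repr (F : fieldType) (gT : finGroupType) (N : {group gT}) n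
    (rN : mx_representation F N n) (x : gT) (nNx : x \in 'N(N)) :=
  MxRepresentation (mx_repr_conj rN nNx).

Lemma conj_repr_abs_irr (F : fieldType) (gT : finGroupType) (N : {group gT}) n
    (rN : mx_representation F N n) (x : gT) (nNx : x \in 'N(N)) :
  mx_absolutely_irreducible rN -> mx_absolutely_irreducible (conj_repr rN nNx).
Proof.
case/mx_abs_irrP=> n_gt0 [a aE]; apply/mx_abs_irrP; split=> //.
exists (fun g A => a (g ^ x^-1)%g A) => A; rewrite {1}[A]aE.
rewrite (reindex_inj (conjg_inj x^-1%g)) /=; apply: eq_bigl => g.
by rewrite memJ_norm ?groupV.
Qed.

(** As [x * g = (g ^ x^-1) * x], right multiplication by [rG x] maps [M] onto [M *m rG x] and turns
    the action of [g ^ x^-1] into that of [g]. *)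
Lemma rsim_submod_conj (F : fieldType) (gT : finGroupType) (G N : {group gT}) n
    (rG : mx_representation F G n) (sNG : N \subset G) (x : gT)
    (nNx : x \in 'N(N)) (M : 'M_n) (modM : mxmodule (subg_repr rG sNG) M)
    (modMx : mxmodule (subg_repr rG sNG) (M *m rG x)) :
  x \in G -> mx_rsim (submod_repr modMx) (conj_repr (submod_repr modM) nNx).
Proof.
move=> Gx; apply: mx_rsim_sym.
have free_x : row_free (rG x) by rewrite row_free_unit repr_mx_unit.
have eq_rk : \rank M = \rank (M *m rG x) by rewrite mxrankMfree.
exists (in_submod (M *m rG x) (val_submod 1%:M *m rG x)) => // [|g Ng].
  rewrite /row_free {6}eq_rk -[_ == _]sub1mx -val_submodS.
  rewrite in_submodK; last by rewrite submxMr ?val_submodP.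
  by rewrite val_submod1 submxMr ?val_submod1.
have Gg := subsetP sNG g Ng; have nx : (g ^ x^-1)%g \in N by rewrite memJ_norm ?groupV.
rewrite -in_submodJ //=; last by rewrite submxMr ?val_submodP.
rewrite -mulmxA -(repr_mxM rG) // [(x * g)%g]conjgCV (repr_mxM rG) ?(subsetP sNG _ nx) //.
rewrite [in RHS]mulmxA in_submodE [RHS]in_submodE mulmxA; congr (_ *m _).
by rewrite mulmxA -val_submodE -[submod_repr _ _]mul1mx val_submodJ.
Qed.

Lemma char_poly_sim (F : fieldType) n (P A B : 'M[F]_n) :
  P \in unitmx -> P *m A = B *m P -> char_poly A = char_poly B.
Proof.
move=> uP simAB; pose P' := map_mx (@polyC F) P.
have detP : \det P' != 0.
  by rewrite det_map_mx /= polyC_eq0 -unitfE -unitmxE.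
apply: (mulfI detP); rewrite /char_poly -det_mulmx [RHS]mulrC -det_mulmx.
by rewrite /char_poly_mx mulmxBr mulmxBl -!map_mxM simAB scalar_mxC.
Qed.

Lemma char_poly_rsim (F : fieldType) (gT : finGroupType) (G : {group gT}) n1 n2
    (r1 : mx_representation F G n1) (r2 : mx_representation F G n2) :
  mx_rsim r1 r2 -> {in G, forall x, char_poly (r1 x) = char_poly (r2 x)}.
Proof.
case/mx_rsim_sym=> B eq_n; move: r2 B; rewrite eq_n => r2 B.
rewrite row_free_unit => uB homB x Gx; symmetry.
by apply: (char_poly_sim (P := invmx B)); rewrite ?unitmx_inv // -[LHS](mulmxK uB)
  -[_ *m B]mulmxA homB // mulKmx.
Qed.

Lemma char_poly_block (F : fieldType) n1 n2 (A : 'M[F]_n1) (B : 'M[F]_n2) :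
  char_poly (block_mx A 0 0 B) = char_poly A * char_poly B.
Proof.
rewrite /char_poly /char_poly_mx map_block_mx scalar_mx_block.
by rewrite opp_block_mx add_block_mx !map_mx0 !subr0 det_ublock.
Qed.

(** The minimal polynomial divides [X^m - 1], a product of distinct linear factors, so [A] is
    diagonalizable with [m]-th roots of unity as eigenvalues. *)
Lemma char_poly_unity_split (F : fieldType) n m (A : 'M[F]_n) (rs : seq F) :
    uniq rs -> 'X^m - 1 = \prod_(a <- rs) ('X - a%:P) -> A ^+ m = 1 ->
  exists2 s : seq F, char_poly A = \prod_(a <- s) ('X - a%:P) &
    {in s, forall a, a ^+ m = 1}.
Proof.
case: n A => [|n] A Urs def_rs Am1.
  exists [::]; rewrite ?big_nil //; exact: det_mx00.
have dvdA : mxminpoly A %| 'X^m - 1.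
  by apply: mxminpoly_min; rewrite rmorphB rmorphXn rmorph1 /= horner_mx_X Am1 subrr.
have [P uP] : diagonalizable A.
  by apply/diagonalizableP; exists rs; rewrite // -def_rs.
case/diagonalizable_forPex=> D /(simmxP uP) simA.
have cpA : char_poly A = \prod_(a <- [seq D 0 i | i <- enum 'I_n.+1]) ('X - a%:P).
  transitivity (char_poly (diag_mx D)).
    exact: (char_poly_sim uP).
  rewrite char_poly_trig ?diag_mx_is_trig // big_map big_enum /=.
  by apply: eq_bigr => i _; rewrite mxE eqxx mulr1n.
exists [seq D 0 i | i <- enum 'I_n.+1] => // a Da.
have : root (char_poly A) a by rewrite cpA root_prod_XsubC.
rewrite -root_mxminpoly => /(root_dvdp dvdA).
by rewrite rootE !hornerE subr_eq0 => /eqP.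
Qed.

(** * Passage to the odd part of a group element *)

Local Notation oddpart x := (x.`_(2%N^'))%g.

Lemma odd_constt (gT : finGroupType) (x : gT) : odd #[oddpart x].
Proof. by rewrite odd_2'nat; apply: p_elt_constt. Qed.

(** If [2 ^ k] is the 2-part of the order of [x], then [x] and its odd part have the same [2 ^ k]-th
    power, and squaring is injective on [F]. *)
Lemma sqr_fun_odd_part (F : fieldType) (gT : finGroupType) (G : {group gT})
    (f : gT -> F) : (2 \in [pchar F])%N ->
    {in G, forall x, f (x * x)%g = f x ^+ 2} ->
  {in G, forall x, f (oddpart x) = f x}.
Proof.
move=> ch2 f2 x Gx; have inj_sqr : injective (fun a : F => a ^+ 2).
  by move=> a b /=; rewrite -!(pFrobenius_autE ch2) => /fmorph_inj.
have fX k y : y \in G -> f (y ^+ (2 ^ k))%g = f y ^+ (2 ^ k).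
  move=> Gy; elim: k => [|k IHk]; first by rewrite expn0.
  by rewrite expnSr expgM exprM expgS expg1 f2 ?groupX // IHk.
have := fX (logn 2 #[x]) x Gx; rewrite -[x in (x ^+ _)%g](consttC 2%N x).
rewrite expgMn; last exact: commuteX2 (commute_refl x).
rewrite -p_part -order_constt expg_order mul1g order_constt p_part fX ?groupX //.
elim: (logn 2 #[x]) => [|k IHk]; first by rewrite expn0 !expr1.
by rewrite expnSr !exprM => /inj_sqr.
Qed.

Lemma repr_trace_sqr (F : fieldType) (gT : finGroupType) (G : {group gT}) n
    (rG : mx_representation F G n) : (2 \in [pchar F])%N ->
  {in G, forall x, repr_trace rG (x * x)%g = repr_trace rG x ^+ 2}.
Proof.
by move=> ch2 x Gx; rewrite !repr_traceE ?groupM // repr_mxM // mxtrace_sqr_pchar2.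
Qed.

(** * Roots of unity in [R] and their reduction *)

Section Brauer.
Variables (R : idomainType) (K F : fieldType).
Variables (iota : {rmorphism R -> K}) (red : {rmorphism R -> F}).
Hypothesis ms : modular_system 2 iota red.

Let ch2 : (2 \in [pchar F])%N := ms_charp ms.

(** With [w = x / y] and [x^m = y^m], comparing powers of the uniformizer shows that [x] and [y]
    have equal valuation, so [w] is a unit of [R]. *)
Lemma integrally_closed_unity m (w : K) :
  (0 < m)%N -> w ^+ m = 1 -> exists z : R, iota z = w.
Proof.
move=> m_gt0 wm1; have [[pi [nz_pi nu_pi unif] _] inj_iota frac _ _ _ _] := ms.
have [x [y [nz_y def_w]]] := frac w.
have nz_iota a : a != 0 -> iota a != 0.
  by apply: contraNneq => a0; apply/eqP/inj_iota; rewrite rmorph0.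
have xym : x ^+ m = y ^+ m.
  apply: inj_iota; rewrite !rmorphXn -[RHS]mul1r -wm1 def_w expr_div_n.
  by rewrite divfK // expf_neq0 ?nz_iota.
have nz_x : x != 0.
  apply: contraNneq nz_y => x0; move: xym; rewrite x0 expr0n eqn0Ngt m_gt0 /=.
  by move/esym/eqP; rewrite expf_eq0 => /andP[].
have le_val u v a b : u \is a GRing.unit -> v \is a GRing.unit ->
    (u * pi ^+ a) ^+ m = (v * pi ^+ b) ^+ m -> (b <= a)%N.
  move=> uu uv eq_uv; rewrite leqNgt; apply: contra nu_pi => lt_ab.
  have m_ba : (0 < (b - a) * m)%N by rewrite muln_gt0 subn_gt0 lt_ab.
  have : u ^+ m = v ^+ m * pi ^+ ((b - a) * m).
    apply: (@mulIf _ (pi ^+ (a * m))); first by rewrite expf_neq0.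
    by rewrite -mulrA -exprD -mulnDl subnK 1?ltnW // exprM -exprMn eq_uv exprMn -exprM.
  move=> def_um; have := unitrX m uu; rewrite def_um unitrM => /andP[_].
  by rewrite unitrX_pos.
have [u [a [uu def_x]]] := unif x nz_x; have [v [b [uv def_y]]] := unif y nz_y.
have eq_ab : a = b.
  apply/eqP; rewrite eqn_leq (le_val u v a b) ?(le_val v u b a) //.
    by rewrite -def_x -def_y.
  by rewrite -def_x -def_y.
exists (u / v); rewrite def_w; apply: (canRL (mulfK (nz_iota _ nz_y))).
by rewrite -rmorphM def_x def_y eq_ab mulrA divrK.
Qed.

Section Group.
Variables (gT : finGroupType) (G : {group gT}).
Hypothesis splitK : splitting_for_subgroups K G.
Hypothesis splitF : splitting_for_subgroups F G.

(** A splitting field of characteristic 0 for the cyclic group [<[g]>] contains a primitive root of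
    unity of order [#[g]], which then lies in [R]. *)
Lemma primitive_root_val_ring g : g \in G ->
  exists z : R, #[g].-primitive_root z.
Proof.
move=> Gg; have [_ inj_iota _ _ _ char0 _] := ms.
have [w prim_w] : exists w : K, #[g].-primitive_root w.
  apply: NNPP => no_w.
  suff: false by [].
  apply: (socle_exists (regular_repr K <[g]>)) => sG.
  have [|||w prim_w _] := @cycle_repr_structure_pchar K gT <[g]>%G g sG => //.
  - by apply/pgroupP=> p _ _; rewrite inE /= char0.
  - by apply: splitK; rewrite cycle_subG.
  by case: no_w; exists w.
have [z def_w] := integrally_closed_unity (order_gt0 g) (prim_expr_order prim_w).
exists z; move: prim_w; rewrite -def_w /primitive_root_of_unity.
congr (_ && _); apply: eq_forallb => i; rewrite !unity_rootE.
by rewrite -rmorphXn -(rmorph1 iota) (inj_eq inj_iota).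
Qed.

(** For odd [#[g]] the polynomial [X^#[g] - 1] is separable over [F], so reduction is a bijection
    between the [#[g]]-th roots of unity of [R] and those of [F]. *)
Lemma unity_lift g : g \in G -> odd #[g] ->
  exists (lift : F -> R) (rs : seq F),
  [/\ uniq rs, 'X^#[g] - 1 = \prod_(a <- rs) ('X - a%:P),
      forall a, a ^+ #[g] = 1 -> (lift a) ^+ #[g] = 1 /\ red (lift a) = a &
      forall y : R, y ^+ #[g] = 1 -> lift (red y) = y].
Proof.
move=> Gg og; have [z prim_z] := primitive_root_val_ring Gg.
have [_ inj_iota _ _ _ _ _] := ms.
have eqR : \prod_(0 <= i < #[g]) ('X - (z ^+ i)%:P) = 'X^#[g] - 1.
  apply: (map_inj_poly inj_iota (rmorph0 iota)).
  have prim_iz : #[g].-primitive_root (iota z).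
    move: prim_z; rewrite /primitive_root_of_unity; congr (_ && _).
    apply: eq_forallb => i; rewrite !unity_rootE.
    by rewrite -rmorphXn -(rmorph1 iota) (inj_eq inj_iota).
  rewrite map_prod_XsubC rmorphB rmorphXn rmorph1 /= map_polyX.
  rewrite -(factor_Xn_sub_1 prim_iz); apply: eq_bigr => i _.
  by rewrite rmorphXn.
have eqF : 'X^#[g] - 1 = \prod_(0 <= i < #[g]) ('X - (red (z ^+ i))%:P) :> {poly F}.
  by rewrite -(map_prod_XsubC red) eqR rmorphB rmorphXn rmorph1 /= map_polyX.
pose rs := [seq red (z ^+ i) | i <- index_iota 0 #[g]].
have eqFrs : 'X^#[g] - 1 = \prod_(a <- rs) ('X - a%:P) :> {poly F}.
  by rewrite big_map.
have Urs : uniq rs.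
  rewrite -separable_prod_XsubC -eqFrs separable_Xn_sub_1 //.
  by rewrite -(dvdn_pcharf ch2) dvdn2 og.
(* [rs] lists the reductions of the powers of [z] in order, so the index of [a] in it is the
   exponent of the lift. *)
exists (fun a => z ^+ index a rs), rs; split=> // [a am1 | y ym1].
  have rs_a : a \in rs.
    by rewrite -root_prod_XsubC -eqFrs rootE !hornerE am1 subrr.
  split; first by rewrite exprAC (prim_expr_order prim_z) expr1n.
  have lt_a : (index a rs < #[g])%N.
    by rewrite -index_mem size_map size_iota subn0 in rs_a *.
  rewrite -[RHS](nth_index 0 rs_a) (nth_map 0%N) ?size_iota ?subn0 //.
  by rewrite nth_iota ?add0n // subn0.
have : root ('X^#[g] - 1) y by rewrite rootE !hornerE ym1 subrr.
rewrite -eqR -(big_map (fun i => z ^+ i) xpredT (fun a => 'X - a%:P)) root_prod_XsubC.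
case/mapP=> i; rewrite mem_index_iota => /= ltig ->; congr (_ ^+ _).
rewrite -[X in _ = X](index_uniq 0 (_ : i < size rs)%N Urs);
  rewrite ?size_map ?size_iota ?subn0 //.
by rewrite (nth_map 0%N) ?size_iota ?subn0 // nth_iota ?subn0.
Qed.

(** * Brauer characters of a subgroup and their reduction *)

Section Subgroup.
Variables (H : {group gT}).
Hypothesis sHG : H \subset G.

Lemma brauer_character_exists n (rG : mx_representation F H n) :
  exists theta, is_brauer_character red rG theta.
Proof.
have /fin_all_exists[v vE] g : exists v : R,
    (g \in two_regular H -> exists s : seq R,
       [/\ all (#[g].-unity_root) s,
           char_poly (rG g) = \prod_(z <- s) ('X - (red z)%:P) &
           v = \sum_(z <- s) z]) /\ (g \notin two_regular H -> v = 0).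
- have [Hg|nHg] := boolP (g \in two_regular H); last by exists 0.
  have [Hg' og] : g \in H /\ odd #[g] by move: Hg; rewrite inE => /andP[].
  have [lift [rs [Urs def_rs liftP _]]] := unity_lift (subsetP sHG g Hg') og.
  have gm1 : rG g ^+ #[g] = 1.
    have rX k : rG g ^+ k = rG (g ^+ k)%g.
      elim: k => [|k IHk]; first by rewrite expr0 repr_mx1.
      by rewrite exprS IHk expgS repr_mxM ?groupX.
    by rewrite rX expg_order repr_mx1.
  have [s cps s1] := char_poly_unity_split Urs def_rs gm1.
  exists (\sum_(z <- map lift s) z); split=> // _; exists (map lift s); split=> //.
    apply/allP=> _ /mapP[a sa ->]; rewrite unity_rootE.
    by have [-> _] := liftP a (s1 a sa).
  rewrite cps big_map; apply: eq_big_seq => a sa.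
  by have [_ ->] := liftP a (s1 a sa).
exists [ffun g => v g]; split=> g Hg; have [v1 v2] := vE g; rewrite ffunE.
  exact: v1.
exact: v2.
Qed.

(** The eigenvalues over [F] are determined by the characteristic polynomial, and lifting them gives
    back the list over [R]. *)
Lemma brauer_character_uniq n1 n2 (r1 : mx_representation F H n1)
    (r2 : mx_representation F H n2) theta1 theta2 :
    is_brauer_character red r1 theta1 -> is_brauer_character red r2 theta2 ->
    {in H, forall g, char_poly (r1 g) = char_poly (r2 g)} ->
  theta1 = theta2.
Proof.
move=> [b1 z1] [b2 z2] eqcp; apply/ffunP=> g.
have [Hg|nHg] := boolP (g \in two_regular H); last by rewrite z1 ?z2.
have [Hg' og] : g \in H /\ odd #[g] by move: Hg; rewrite inE => /andP[].
have [s1 [u1 cp1 ->]] := b1 g Hg; have [s2 [u2 cp2 ->]] := b2 g Hg.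
have [lift [rs [_ _ _ liftK]]] := unity_lift (subsetP sHG g Hg') og.
have mapK s : all #[g].-unity_root s -> [seq lift a | a <- [seq red y | y <- s]] = s.
  move/allP=> us; rewrite -map_comp -[RHS]map_id; apply/eq_in_map => y /us.
  by rewrite unity_rootE => /eqP ym1; apply: liftK.
rewrite -(mapK s1 u1) -(mapK s2 u2) !(big_map lift).
apply: perm_big; apply: prod_XsubC_eq.
by rewrite !(big_map red) -cp1 -cp2 eqcp.
Qed.

Lemma brauer_character_rsim n1 n2 (r1 : mx_representation F H n1)
    (r2 : mx_representation F H n2) theta1 theta2 :
    is_brauer_character red r1 theta1 -> is_brauer_character red r2 theta2 ->
  mx_rsim r1 r2 -> theta1 = theta2.
Proof.
by move=> b1 b2 /char_poly_rsim eqcp; apply: brauer_character_uniq b1 b2 eqcp.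
Qed.

Lemma brauer_character_trace n (rG : mx_representation F H n) theta :
    is_brauer_character red rG theta ->
  {in two_regular H, forall g, red (theta g) = \tr (rG g)}.
Proof.
case=> b _ g /b[s [_ cps ->]].
have sz_s : size s = n.
  apply: succn_inj; rewrite -(size_char_poly (rG g)) cps.
  by rewrite -(big_map red xpredT (fun a => 'X - a%:P)) size_prod_XsubC size_map.
(* Degree 0 is treated apart because the trace is read off the coefficient just below the leading
   one. *)
case: (posnP n) => [n0 | n_gt0].
  rewrite (size0nil (etrans sz_s n0)) big_nil rmorph0; move: (rG g); rewrite n0 => A.
  by rewrite /mxtrace big_ord0.
apply: oppr_inj; rewrite -char_poly_trace // cps.
rewrite -(big_map red xpredT (fun a => 'X - a%:P)) -sz_s -(size_map red s).
rewrite coefPn_prod_XsubC ?size_map ?sz_s -?lt0n //.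
by rewrite big_map rmorph_sum.
Qed.

Definition brauer_trace (theta : {ffun gT -> R}) : {ffun gT -> F} :=
  [ffun g => if g \in H then red (theta (oddpart g)) else 0].

(** The trace function satisfies [f (g^2) = (f g)^2], so its value at [g] is its value at the odd
    part of [g]. *)
Lemma brauer_traceE n (rG : mx_representation F H n) theta :
  is_brauer_character red rG theta -> brauer_trace theta = repr_trace rG.
Proof.
move=> b; apply/ffunP=> g; rewrite [LHS]ffunE; case: ifP => [Hg|nHg];
  last by rewrite ffunE nHg.
rewrite (brauer_character_trace b) ?inE ?groupX ?odd_constt // -repr_traceE ?groupX //.
exact: sqr_fun_odd_part (repr_trace_sqr rG ch2) g Hg.
Qed.

Lemma brauer_trace_irr theta :
  irr_brauer red H theta -> irr_trace H (brauer_trace theta).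
Proof. by case=> n [rG [irr b]]; exists n, rG; rewrite (brauer_traceE b). Qed.

Lemma irr_trace_lift t : irr_trace H t ->
  exists2 theta, irr_brauer red H theta & brauer_trace theta = t.
Proof.
case=> n [rG [irr ->]]; have [theta b] := brauer_character_exists rG.
by exists theta; [exists n, rG | apply: brauer_traceE].
Qed.

(** Irreducible modules with equal traces are isomorphic, hence have the same eigenvalues. *)
Lemma brauer_trace_inj theta1 theta2 :
    irr_brauer red H theta1 -> irr_brauer red H theta2 ->
  brauer_trace theta1 = brauer_trace theta2 -> theta1 = theta2.
Proof.
case=> n1 [r1 [irr1 b1]] [n2 [r2 [irr2 b2]]].
rewrite (brauer_traceE b1) (brauer_traceE b2) => eqtr.
exact: brauer_character_rsim b1 b2 (irr_trace_rsim (splitF sHG) irr1 irr2 eqtr).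
Qed.

Lemma irr_brauer_dual theta :
  irr_brauer red H theta -> irr_brauer red H (brauer_dual theta).
Proof.
case=> n [rG [irr [b z]]]; exists n, (dual_repr rG); split.
  exact/mx_abs_irrW/dual_repr_abs_irr/(splitF sHG irr).
have regV g : (g^-1%g \in two_regular H) = (g \in two_regular H).
  by rewrite !inE groupV orderV.
split=> g; rewrite -regV ffunE; last exact: z.
(* The list for [theta] at [g^-1] serves for the dual at [g], as transposition keeps the
   characteristic polynomial. *)
case/b=> s [us cps ->]; exists s; split=> //; first by rewrite -orderV.
rewrite -cps /= /char_poly -[RHS]det_tr /char_poly_mx linearB /= tr_scalar_mx.
by rewrite map_trmx.
Qed.

Lemma brauer_conj_character n (rG : mx_representation F H n) theta x
    (nHx : x \in 'N(H)) :
    is_brauer_character red rG theta ->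
  is_brauer_character red (conj_repr rG nHx) (brauer_conj x theta).
Proof.
have regJ g : (g \in two_regular H) = ((g ^ x^-1)%g \in two_regular H).
  by rewrite !inE memJ_norm ?groupV // orderJ.
have conjE g : (x * g * x^-1 = g ^ x^-1)%g by rewrite conjgE invgK mulgA.
case=> b z; split=> g; rewrite regJ ffunE conjE; last exact: z.
by case/b=> s [us cps ->]; exists s; split=> //; rewrite -(orderJ g x^-1%g).
Qed.

Lemma irr_brauer_conj theta x : x \in 'N(H) ->
  irr_brauer red H theta -> irr_brauer red H (brauer_conj x theta).
Proof.
move=> nHx [n [rG [irr b]]]; exists n, (conj_repr rG nHx); split.
  exact/mx_abs_irrW/conj_repr_abs_irr/(splitF sHG irr).
exact: brauer_conj_character.
Qed.

Lemma brauer_character_dsum (I : finType) (P : pred I)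
    (rI : I -> representation F H) (theta : I -> {ffun gT -> R}) :
    (forall i, is_brauer_character red (rI i) (theta i)) ->
  is_brauer_character red (\big[@dadd_grepr _ _ H/@grepr0 _ _ H]_(i | P i) rI i)
    (\sum_(i | P i) theta i).
Proof.
move=> bI; apply: (big_rec2 (fun (r : representation F H) th =>
    is_brauer_character red r th)) => [|i th r _ b].
  split=> g _; last by rewrite ffunE.
  by exists [::]; rewrite !big_nil ffunE; split=> //; apply: det_mx00.
case: (bI i) (b) => b1 z1 [b2 z2]; split=> g Hg; rewrite ffunE; last first.
  by rewrite z1 ?z2 ?addr0.
have [s1 [u1 cp1 ->]] := b1 g Hg; have [s2 [u2 cp2 ->]] := b2 g Hg.
exists (s1 ++ s2); rewrite all_cat u1 u2 !big_cat /= -cp1 -cp2; split=> //.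
exact: char_poly_block.
Qed.

End Subgroup.

(** * Restriction to a normal subgroup and Clifford's theorem *)

Lemma brauer_restriction_character (N : {group gT}) n (rG : mx_representation F G n)
    theta (sNG : N \subset G) :
    is_brauer_character red rG theta ->
  is_brauer_character red (subg_repr rG sNG) (brauer_res N theta).
Proof.
case=> b z; split=> g; rewrite inE ffunE.
  by case/andP=> Ng og; rewrite Ng; apply: b; rewrite inE og (subsetP sNG).
by case: ifP => //= Ng nog; apply: z; rewrite inE negb_and nog orbT.
Qed.

(** The restricted module is a direct sum of translates [M *m rG x] of a simple submodule [M], and
    each translate is a conjugate of [M]. Isomorphic translates are counted separately. *)
Lemma brauer_Clifford (N : {group gT}) theta : (N <| G)%g ->
    irr_brauer red G theta ->
  exists (chi : {ffun gT -> R}) (X : {set gT}),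
    [/\ irr_brauer red N chi, X \subset G &
        brauer_res N theta = \sum_(x in X) brauer_conj x chi].
Proof.
move=> nsNG [n [rG [irrG b]]]; pose sNG := normal_sub nsNG.
have nNG x : x \in G -> x \in 'N(N) by apply/subsetP/normal_norm.
pose rN := subg_repr rG sNG.
have nz1 : 1%:M != 0 :> 'M[F]_n.
  by rewrite -mxrank_eq0 mxrank1 -lt0n; case/mx_irrP: irrG.
have [M simM _] := classically_elim (mxsimple_exists (mxmodule1 rN) nz1).
have [modM _ _] := simM.
have [chi bchi] := brauer_character_exists sNG (submod_repr modM).
have [X sXG [defX dxX]] := Clifford_basis irrG simM.
exists chi, X; split=> //.
  by exists _, (submod_repr modM); split=> //; apply/submod_mx_irr.
(* The direct sum needs a submodule for every index in [gT]; outside [X] the default 1 keeps [y x]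
   in [G]. *)
pose y x := if x \in X then x else 1%g.
have Gy x : y x \in G by rewrite /y; case: ifP => // /(subsetP sXG).
have yX x : x \in X -> y x = x by rewrite /y => ->.
have modU x : mxmodule rN (M *m rG (y x)).
  by have [] := Clifford_simple simM (Gy x).
pose rU x := Representation (conj_repr (submod_repr modM) (nNG _ (Gy x))).
have simU x : mx_rsim (submod_repr (modU x)) (rU x) by apply: rsim_submod_conj.
have defU : (\sum_(x in X) M *m rG (y x) = \sum_(x in X) M *m rG x)%MS.
  by apply: eq_bigr => x Xx; rewrite yX.
have := @mx_rsim_dsum _ _ _ _ _ _ (mem X) (fun x => M *m rG (y x)) rU _ modU (mxmodule1 rN).
case/(_ _ _ simU)=> [||B eq_n freeB homB].
- by rewrite /= defU.
- move: dxX; rewrite !mxdirectE /= defU.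
  by congr (_ == _); apply: eq_bigr => x Xx; rewrite yX.
have simN := MxReprSim eq_n freeB homB.
have bN := brauer_restriction_character sNG b.
have sim1 : mx_rsim (submod_repr (mxmodule1 rN)) rN by apply: rsim_submod1.
have bU x : is_brauer_character red (rU x) (brauer_conj (y x) chi).
  exact: brauer_conj_character.
have bsum := brauer_character_dsum (mem X) bU.
rewrite (brauer_character_rsim sNG bN bsum (mx_rsim_trans (mx_rsim_sym sim1) simN)).
by apply: eq_bigr => x Xx; rewrite yX.
Qed.

End Group.
End Brauer.

(** * Self-dual Brauer characters over a normal subgroup *)

Lemma brauer_dualK (R : idomainType) (gT : finGroupType) :
  involutive (@brauer_dual R gT).
Proof. by move=> t; apply/ffunP=> g; rewrite !ffunE invgK. Qed.

Lemma brauer_conjM (R : idomainType) (gT : finGroupType) x y (t : {ffun gT -> R}) :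
  brauer_conj x (brauer_conj y t) = brauer_conj (y * x)%g t.
Proof. by apply/ffunP=> g; rewrite !ffunE invMg !mulgA. Qed.

Lemma brauer_conj1 (R : idomainType) (gT : finGroupType) (t : {ffun gT -> R}) :
  brauer_conj 1 t = t.
Proof. by apply/ffunP=> g; rewrite !ffunE invg1 mul1g mulg1. Qed.

Lemma brauer_conj_inj (R : idomainType) (gT : finGroupType) x :
  injective (@brauer_conj R gT x).
Proof.
by apply: (can_inj (g := brauer_conj x^-1)) => t; rewrite brauer_conjM mulgV brauer_conj1.
Qed.

Lemma brauer_dual_conj (R : idomainType) (gT : finGroupType) x (t : {ffun gT -> R}) :
  brauer_dual (brauer_conj x t) = brauer_conj x (brauer_dual t).
Proof. by apply/ffunP=> g; rewrite !ffunE !invMg invgK !mulgA. Qed.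

Lemma perm_map_inj_stable (T : eqType) (f : T -> T) (r : seq T) :
  uniq r -> injective f -> {in r, forall x, f x \in r} -> perm_eq [seq f x | x <- r] r.
Proof.
move=> Ur inj_f rf; have Ufr : uniq [seq f x | x <- r] by rewrite map_inj_uniq.
have sub : {subset [seq f x | x <- r] <= r} by move=> _ /mapP[x rx ->]; apply: rf.
have [|_ eqr] := uniq_min_size Ufr sub; first by rewrite size_map.
exact: uniq_perm.
Qed.

Lemma natr_odd_pchar2 (F : fieldType) n : (2 \in [pchar F])%N -> n%:R = (odd n)%:R :> F.
Proof.
move=> ch2; rewrite -[in LHS](odd_double_half n) natrD -muln2 natrM.
by rewrite (pcharf0 ch2) mulr0 addr0.
Qed.

Section GringFun.
Variables (F : fieldType) (gT : finGroupType) (G : {group gT}).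

Lemma eq_gring_fun (f h : gT -> F) (A : 'M[F]_#|G|) :
  {in G, f =1 h} -> gring_fun f A = gring_fun h A.
Proof. by move=> eq_fh; apply: eq_bigr => x Gx; rewrite eq_fh. Qed.

Lemma gring_fun_lincomb (I : Type) (r : seq I) (c : I -> F) (f : I -> gT -> F)
    (A : 'M[F]_#|G|) :
  gring_fun (fun x => \sum_(i <- r) c i * f i x) A = \sum_(i <- r) c i * gring_fun (f i) A.
Proof.
rewrite /gring_fun; under eq_bigr => x _ do rewrite mulr_sumr.
rewrite exchange_big; apply: eq_bigr => i _; rewrite mulr_sumr.
by apply: eq_bigr => x _; rewrite mulrCA.
Qed.

Lemma irr_traceC t : irr_trace G t -> {in G &, forall x y, t (x * y)%g = t (y * x)%g :> F}.
Proof.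
move=> [n [rG [_ ->]]] x y Gx Gy.
by rewrite !repr_traceE ?groupM // !repr_mxM // mxtrace_mulC.
Qed.

Lemma irr_trace_sqr t : (2 \in [pchar F])%N -> irr_trace G t ->
  {in G, forall x, t (x * x)%g = t x ^+ 2 :> F}.
Proof. by move=> ch2 [n [rG [_ ->]]]; apply: repr_trace_sqr. Qed.

Lemma irr_trace_out t x : irr_trace G t -> x \notin G -> t x = 0 :> F.
Proof. by move=> [n [rG [_ ->]]] nGx; rewrite ffunE (negPf nGx). Qed.

End GringFun.

Section Brauer.
Variables (R : idomainType) (K F : fieldType).
Variables (iota : {rmorphism R -> K}) (red : {rmorphism R -> F}).
Hypothesis ms : modular_system 2 iota red.

Let ch2 : (2 \in [pchar F])%N := ms_charp ms.

Variables (gT : finGroupType) (G : {group gT}).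
Hypothesis splitK : splitting_for_subgroups K G.
Hypothesis splitF : splitting_for_subgroups F G.

(** * Uniqueness of the decomposition into irreducible Brauer characters *)

Section Subgroup.
Variables (H : {group gT}).
Hypothesis sHG : H \subset G.

Local Notation btrace := (brauer_trace red H).

Lemma brauer_traceD theta1 theta2 : btrace (theta1 + theta2) = btrace theta1 + btrace theta2.
Proof.
by apply/ffunP=> g; rewrite !ffunE; case: ifP; rewrite ?addr0 // rmorphD.
Qed.

Lemma brauer_trace0 : btrace 0 = 0.
Proof. by apply/ffunP=> g; rewrite !ffunE rmorph0 if_same. Qed.

Lemma brauer_trace_dual theta : btrace (brauer_dual theta) = brauer_dual (btrace theta).
Proof. by apply/ffunP=> g; rewrite !ffunE groupV consttV. Qed.

Lemma brauer_trace_conj theta x : x \in 'N(H) ->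
  btrace (brauer_conj x theta) = brauer_conj x (btrace theta).
Proof.
move=> nHx; apply/ffunP=> g; rewrite !ffunE.
have conjE h : (x * h * x^-1 = h ^ x^-1)%g by rewrite conjgE invgK mulgA.
by rewrite !conjE memJ_norm ?groupV // consttJ.
Qed.

Lemma irr_trace_dual t : irr_trace H t -> irr_trace H (brauer_dual t : {ffun gT -> F}).
Proof.
case/(irr_trace_lift ms splitK sHG)=> theta irr <-; rewrite -brauer_trace_dual.
exact: (brauer_trace_irr ms (irr_brauer_dual splitF sHG irr)).
Qed.

Lemma irr_trace_conj t x : x \in 'N(H) ->
  irr_trace H t -> irr_trace H (brauer_conj x t : {ffun gT -> F}).
Proof.
move=> nHx /(irr_trace_lift ms splitK sHG)[theta irr <-].
rewrite -brauer_trace_conj //.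
exact: (brauer_trace_irr ms (irr_brauer_conj splitF sHG nHx irr)).
Qed.

(** On sums of irreducible members of [u] and of [phi], [D] is the multiplicity of [phi] modulo
    2. *)
Lemma irr_brauer_coef (u : seq {ffun gT -> R}) phi : irr_brauer red H phi ->
  exists D : {ffun gT -> R} -> F,
    [/\ {morph D : a b / a + b}, D 0 = 0, D phi = 1 &
        forall chi, chi \in u -> irr_brauer red H chi -> chi != phi -> D chi = 0].
Proof.
move=> irr_phi; have irr_t := brauer_trace_irr ms irr_phi.
have [A _ [tA uA]] := irr_trace_dual_basis (splitF sHG) [seq btrace chi | chi <- u] irr_t.
exists (fun chi => gring_fun (btrace chi) A); split=> // [a b||chi u_chi irr_chi ne].
- rewrite brauer_traceD -big_split; apply: eq_bigr => x _ /=.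
  by rewrite ffunE mulrDr.
- by rewrite brauer_trace0 /gring_fun big1 // => x _; rewrite ffunE mulr0.
apply: uA; [exact: map_f | exact: (brauer_trace_irr ms irr_chi) |].
apply: contra_neq ne; exact: (brauer_trace_inj ms splitK splitF sHG).
Qed.

(** The coefficients agree modulo 2; once their odd parts are removed both sums can be halved, since
    2 is nonzero in [R]. Thus binary digits are compared one at a time. *)
Lemma irr_brauer_free (u : seq {ffun gT -> R}) (a b : {ffun gT -> R} -> nat) :
    uniq u -> {in u, forall chi, irr_brauer red H chi} ->
    \sum_(chi <- u) chi *+ a chi = \sum_(chi <- u) chi *+ b chi ->
  {in u, a =1 b}.
Proof.
(* The induction is on a common bound for the multiplicities, which halving lowers. *)
move=> Uu irr_u; have [n] : exists n,
    {in u, forall chi, (a chi <= n)%N /\ (b chi <= n)%N}.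
  exists (\max_(chi <- u) maxn (a chi) (b chi)) => chi u_chi.
  by apply/andP; rewrite -geq_max (bigD1_seq chi) //= leq_maxl.
elim: n => [|n IHn] in a b *.
  by move=> ab0 _ chi /ab0; rewrite !leqn0 => -[/eqP-> /eqP->].
move=> le_ab eq_ab.
have odd_ab : {in u, forall chi, odd (a chi) = odd (b chi)}.
  move=> phi u_phi; have [D [DD D0 Dphi Du]] := irr_brauer_coef u (irr_u _ u_phi).
  have DE (e : {ffun gT -> R} -> nat) :
      D (\sum_(chi <- u) chi *+ e chi) = (odd (e phi))%:R.
    rewrite (big_morph D DD D0) (bigD1_seq phi) //= big_seq_cond big1.
      rewrite addr0 -(natr_odd_pchar2 _ ch2).
      by elim: (e phi) => [|k IHk]; rewrite ?mulr0n // !mulrS DD IHk Dphi.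
    move=> chi /andP[u_chi ne]; have D0' := Du _ u_chi (irr_u _ u_chi) ne.
    by elim: (e chi) => [|k IHk]; rewrite ?mulr0n // !mulrS DD IHk D0' addr0.
  have := congr1 D eq_ab; rewrite !DE => /eqP.
  by case: (odd _) (odd _) => [] [] //; rewrite ?(eq_sym 0) oner_eq0.
have nz2 : 2%:R != 0 :> R.
  have [_ inj_iota _ _ _ char0 _] := ms.
  apply/eqP=> /(congr1 iota); rewrite rmorph0 rmorph_nat => /eqP two0.
  by have := char0 2%N; rewrite !inE two0.
have splitE (e : {ffun gT -> R} -> nat) : \sum_(chi <- u) chi *+ e chi =
    \sum_(chi <- u) chi *+ odd (e chi) + (\sum_(chi <- u) chi *+ (e chi)./2) *+ 2.
  rewrite -sumrMnl -big_split; apply: eq_bigr => chi _ /=.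
  by rewrite -mulrnA -mulrnDr muln2 odd_double_half.
have half_ab : {in u, (fun chi => (a chi)./2) =1 (fun chi => (b chi)./2)}.
  apply: IHn => [chi /le_ab[lea leb]|].
    have le_half k : (k <= n.+1)%N -> (k./2 <= n)%N.
      move=> lek; rewrite leq_half_double (leq_trans lek) //.
      by rewrite ltnS -addnn leq_addr.
    by split; apply: le_half.
  have := eq_ab; rewrite (splitE a) (splitE b).
  have -> : \sum_(chi <- u) chi *+ odd (a chi) = \sum_(chi <- u) chi *+ odd (b chi).
    by apply: eq_big_seq => chi u_chi; rewrite odd_ab.
  move/addrI=> /ffunP eq2; apply/ffunP=> g; have := eq2 g.
  by rewrite !ffunMnE -[LHS]mulr_natr -[RHS]mulr_natr => /(mulIf nz2).
move=> chi u_chi.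
by rewrite -(odd_double_half (a chi)) -(odd_double_half (b chi)) odd_ab // half_ab.
Qed.

(** Hence the multiplicity of a constituent depends only on the sum, not on the chosen list. *)
Lemma irr_brauer_perm (s1 s2 : seq {ffun gT -> R}) :
    {in s1, forall chi, irr_brauer red H chi} ->
    {in s2, forall chi, irr_brauer red H chi} ->
    \sum_(chi <- s1) chi = \sum_(chi <- s2) chi ->
  perm_eq s1 s2.
Proof.
move=> irr1 irr2; pose u := undup (s1 ++ s2).
have Uu : uniq u by apply: undup_uniq.
have sumE s : {subset s <= u} ->
    \sum_(chi <- s) chi = \sum_(chi <- u) chi *+ count_mem chi s.
  elim: s => [|x s IHs] su; first by rewrite big_nil big1.
  rewrite big_cons IHs => [|y sy]; last by rewrite su // inE sy orbT.
  rewrite /=; under [RHS]eq_bigr => chi _ do rewrite mulrnDr.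
  rewrite [RHS]big_split /=; congr (_ + _).
  rewrite (bigD1_seq x) ?su ?mem_head //= eqxx mulr1n big1 ?addr0 // => chi ne.
  by rewrite eq_sym (negPf ne).
have su1 : {subset s1 <= u} by move=> x sx; rewrite mem_undup mem_cat sx.
have su2 : {subset s2 <= u} by move=> x sx; rewrite mem_undup mem_cat sx orbT.
rewrite (sumE s1) // (sumE s2) // => eq12.
have irr_u : {in u, forall chi, irr_brauer red H chi}.
  by move=> chi; rewrite mem_undup mem_cat => /orP[/irr1 | /irr2].
have cnt := irr_brauer_free Uu irr_u eq12.
apply/allP=> chi; rewrite -mem_undup => u_chi; apply/eqP; exact: cnt.
Qed.

End Subgroup.

(** * Self-duality above forces conjugacy to the dual below *)

Lemma conjugate_dual_of_self_dual (N : {group gT}) phi theta : (N <| G)%g ->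
    irr_brauer red G theta -> theta = brauer_dual theta ->
    brauer_constituent red N phi (brauer_res N theta) ->
  exists2 x : gT, x \in G & brauer_conj x phi = brauer_dual phi.
Proof.
move=> nsNG irr_th sd_th [m m_gt0 [s [irr_s res_s cnt_s]]].
have sNG := normal_sub nsNG.
have nNG x : x \in G -> x \in 'N(N) by apply/subsetP/normal_norm.
have s_phi : phi \in s by rewrite -has_pred1 has_count cnt_s.
have [chi [X [irr_chi sXG res_X]]] := brauer_Clifford ms splitK nsNG irr_th.
have sum_X : \sum_(psi <- [seq brauer_conj x chi | x <- enum X]) psi = brauer_res N theta.
  by rewrite big_map big_enum res_X.
have irr_X : {in [seq brauer_conj x chi | x <- enum X], forall psi, irr_brauer red N psi}.
  move=> psi /mapP[x]; rewrite mem_enum => Xx ->.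
  by apply: (irr_brauer_conj splitF sNG) => //; apply/nNG/(subsetP sXG).
have perm_sX := irr_brauer_perm sNG irr_s irr_X (etrans (esym res_s) (esym sum_X)).
have mem_X psi : psi \in s -> exists2 x, x \in G & psi = brauer_conj x chi.
  rewrite (perm_mem perm_sX) => /mapP[x]; rewrite mem_enum => Xx ->.
  by exists x => //; apply: (subsetP sXG).
(* The list of duals of [s] has the same sum as [s], so it is a permutation of [s], which therefore
   contains the dual of [phi]. *)
have dual_res : \sum_(psi <- [seq brauer_dual psi | psi <- s]) psi = brauer_res N theta.
  rewrite big_map; apply/ffunP=> g.
  transitivity (brauer_res N theta g^-1%g).
    by rewrite res_s !sum_ffunE; apply: eq_bigr => psi _; rewrite ffunE.
  by rewrite !ffunE groupV {1}sd_th ffunE invgK.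
have irr_ds : {in [seq brauer_dual psi | psi <- s], forall psi, irr_brauer red N psi}.
  by move=> _ /mapP[psi /irr_s irr_psi ->]; apply: (irr_brauer_dual splitF sNG irr_psi).
have perm_ds := irr_brauer_perm sNG irr_ds irr_s (etrans dual_res res_s).
have /mem_X[x Gx def_phi] := s_phi.
have /mem_X[z Gz def_dphi] : brauer_dual phi \in s.
  by rewrite -(perm_mem perm_ds) map_f.
exists (x^-1 * z)%g; first by rewrite groupM ?groupV.
by rewrite def_dphi def_phi brauer_conjM mulKVg.
Qed.

(** * Construction of a self-dual character over [phi] *)

Section SelfDual.
Variables (N : {group gT}) (phi : {ffun gT -> R}) (y : gT).
Hypotheses (nsNG : (N <| G)%g) (irr_phi : irr_brauer red N phi).
Hypotheses (Gy : y \in G) (conj_phi : brauer_conj y phi = brauer_dual phi).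

Let sNG : N \subset G := normal_sub nsNG.
Let t := brauer_trace red N phi.

Let nNG x : x \in G -> x \in 'N(N).
Proof. exact/subsetP/normal_norm. Qed.

Let irr_t : irr_trace N t.
Proof. exact: (brauer_trace_irr ms irr_phi). Qed.

Let conj_t : brauer_conj y t = brauer_dual t.
Proof. by rewrite -brauer_trace_conj ?nNG // conj_phi brauer_trace_dual. Qed.

(** Duplicates are removed so that [t] gets coefficient exactly 1 in the orbit sum. *)
Let O := undup [seq (brauer_conj x t : {ffun gT -> F}) | x <- enum G].

Let memO u : reflect (exists2 x, x \in G & u = brauer_conj x t) (u \in O).
Proof.
rewrite mem_undup; apply: (iffP mapP) => -[x Gx ->]; exists x => //.
  by rewrite -mem_enum.
by rewrite mem_enum.
Qed.

Let irrO u : u \in O -> irr_trace N u.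
Proof.
by case/memO=> x Gx ->; apply: (irr_trace_conj sNG _ irr_t); apply: nNG.
Qed.

Let O_conj x : x \in G -> {in O, forall u, brauer_conj x u \in O}.
Proof.
move=> Gx u /memO[z Gz ->]; apply/memO; exists (z * x)%g; rewrite ?groupM //.
by rewrite brauer_conjM.
Qed.

Let O_dual : {in O, forall u, brauer_dual u \in O}.
Proof.
move=> u /memO[z Gz ->]; apply/memO; exists (y * z)%g; rewrite ?groupM //.
by rewrite brauer_dual_conj -conj_t brauer_conjM.
Qed.

(** Members of [O] vanish outside [N], so without the odd part the squaring rule could fail where
    [g] is outside [N] but [g * g] inside. *)
Let f (g : gT) : F := \sum_(u <- O) (u : {ffun gT -> F}) (oddpart g).

Let f_conj g x : x \in G -> f (g ^ x)%g = f g.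
Proof.
move=> Gx; rewrite /f consttJ.
rewrite -(perm_big _ (perm_map_inj_stable (undup_uniq _)
  (@brauer_conj_inj _ _ x) (O_conj Gx))) big_map.
apply: eq_bigr => u _; rewrite ffunE; congr (u _).
by rewrite conjgE !mulgA mulgV mul1g mulgK.
Qed.

Let f_inv g : f g^-1%g = f g.
Proof.
have inj_dual : injective (@brauer_dual F gT) := inv_inj (@brauer_dualK F gT).
rewrite /f consttV.
rewrite -[RHS](perm_big _ (perm_map_inj_stable (undup_uniq _) inj_dual O_dual)) big_map.
by apply: eq_bigr => u _; rewrite ffunE.
Qed.

Let f_comm : {in G &, forall g h, f (g * h)%g = f (h * g)%g}.
Proof.
move=> g h Gg Gh; rewrite -(f_conj (g * h) Gg); congr f.
by rewrite conjgE !mulgA mulVg mul1g.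
Qed.

Let f_sqr : {in G, forall g, f (g * g)%g = f g ^+ 2}.
Proof.
move=> g Gg; rewrite /f -(pFrobenius_autE ch2) rmorph_sum /=.
apply: eq_big_seq => u /irrO irr_u; rewrite pFrobenius_autE.
have -> : oddpart (g * g)%g = (oddpart g * oddpart g)%g.
  by rewrite -[(g * g)%g]/(g ^+ 2)%g consttX.
have := odd_constt g; set h := oddpart g => odd_h.
have [Nh|nNh] := boolP (h \in N); first exact: (irr_trace_sqr ch2 irr_u).
rewrite (irr_trace_out irr_u nNh) expr0n (irr_trace_out irr_u) //.
(* An element of odd order is a power of its square, with exponent [(#[h] + 1) / 2]. *)
apply: contra nNh => Nhh; have -> : h = ((h * h) ^+ (uphalf #[h]))%g.
  rewrite -[(h * h)%g]/(h ^+ 2)%g -expgM mul2n.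
  have -> : (uphalf #[h]).*2 = #[h].+1 by rewrite uphalfE halfK /= odd_h subn0.
  by rewrite expgS expg_order mulg1.
exact: groupX.
Qed.

Let f_restr g : g \in N -> f g = \sum_(u <- O) (u : {ffun gT -> F}) g.
Proof.
move=> Ng; apply: eq_big_seq => u /irrO irr_u.
exact: (sqr_fun_odd_part ch2 (irr_trace_sqr ch2 irr_u)).
Qed.

Lemma self_dual_trace_over : exists (theta : {ffun gT -> F}) (A : 'M[F]_#|N|),
  [/\ irr_trace G theta, brauer_dual theta = theta, gring_fun theta A != 0,
      gring_fun t A = 1 & forall u, irr_trace N u -> u != t -> gring_fun u A = 0].
Proof.
have [L [UL memL]] := irr_trace_enum F G.
have [LN [ULN memLN]] := irr_trace_enum F N.
have [c fc] := class_fun_span (splitF (subxx G)) ch2 f_comm f_sqr UL memL.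
have irrL u : u \in L -> irr_trace G u by move/memL.
have irrLN u : u \in LN -> irr_trace N u by move/memLN.
(* [gring_fun _ A] is the functional that reads off the coefficient of [t] on [N]. *)
have [A RA [tA uA']] := irr_trace_dual_basis (splitF sNG) LN irr_t.
have uA u : irr_trace N u -> gring_fun u A = (u == t)%:R.
  by move=> irr_u; have [->//|ne] := eqVneq u t; apply: uA' => //; apply/memLN.
have inj_dual : injective (@brauer_dual F gT) := inv_inj (@brauer_dualK F gT).
have L_dual : {in L, forall th, brauer_dual th \in L}.
  by move=> th /irrL irr_th; apply/memL; apply: (irr_trace_dual (subxx G)).
have LN_dual : {in LN, forall th, brauer_dual th \in LN}.
  by move=> th /irrLN irr_th; apply/memLN; apply: (irr_trace_dual sNG).
have LN_conj x : x \in G -> {in LN, forall th, brauer_conj x th \in LN}.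
  move=> Gx th /irrLN irr_th; apply/memLN.
  exact: (irr_trace_conj sNG (nNG Gx) irr_th).
(* [f] is invariant under inversion, and its coefficients are unique. *)
have c_dual : {in L, forall th, c (brauer_dual th) = c th}.
  move=> th Lth; apply/eqP; rewrite -subr_eq0; apply/eqP.
  apply: (irr_trace_free (splitF (subxx G)) UL _ _ Lth
    (c := fun u => c (brauer_dual u) - c u)) => // x Gx.
  under eq_bigr => u _ do rewrite mulrBl.
  rewrite sumrB -fc // -(f_inv x) fc ?groupV //; apply/eqP; rewrite subr_eq0.
  rewrite -[X in _ == X](perm_big _ (perm_map_inj_stable UL inj_dual L_dual)) big_map.
  by apply/eqP/eq_bigr => u _; rewrite [in RHS]ffunE invgK.
(* The coefficients [m] of [th] on [N] are constant on [G]-orbits because [th] is a class function.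
   The dual of [th] has coefficient [m (brauer_dual t) = m (brauer_conj y t) = m t] at [t]. *)
have m_dual : {in L, forall th,
    gring_fun (brauer_dual th : {ffun gT -> F}) A = gring_fun th A}.
  move=> th /irrL irr_th.
  have thC : {in N &, forall g h, th (g * h)%g = th (h * g)%g}.
    by move=> g h Ng Nh; rewrite (irr_traceC irr_th) ?(subsetP sNG).
  have thS : {in N, forall g, th (g * g)%g = th g ^+ 2}.
    by move=> g Ng; rewrite (irr_trace_sqr ch2 irr_th) ?(subsetP sNG).
  have [m thm] := class_fun_span (splitF sNG) ch2 thC thS ULN memLN.
  have m_conj x : x \in G -> {in LN, forall u, m (brauer_conj x u) = m u}.
    move=> Gx u LNu; apply/eqP; rewrite -subr_eq0; apply/eqP.
    apply: (irr_trace_free (splitF sNG) ULN _ _ LNu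
      (c := fun u => m (brauer_conj x u) - m u)) => // g Ng.
    under eq_bigr => v _ do rewrite mulrBl.
    rewrite sumrB -thm //.
    have Ngx : (g ^ x)%g \in N by rewrite memJ_norm ?nNG.
    have -> : th g = th (g ^ x)%g.
      have Gg := subsetP sNG g Ng.
      rewrite conjgE (irr_traceC irr_th) ?groupM ?groupV //.
      by rewrite -mulgA mulgV mulg1.
    rewrite thm //; apply/eqP; rewrite subr_eq0.
    rewrite -[X in _ == X](perm_big _
      (perm_map_inj_stable ULN (@brauer_conj_inj _ _ x) (LN_conj x Gx))) big_map.
    apply/eqP/eq_bigr => v _; rewrite [in RHS]ffunE; congr (_ * v _).
    by rewrite conjgE !mulgA mulgV mul1g mulgK.
  have LNt : t \in LN by apply/memLN.
  have mt (e : {ffun gT -> F} -> F) : \sum_(u <- LN) e u * gring_fun u A = e t.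
    rewrite (bigD1_seq t) //= tA mulr1 big_seq_cond big1 ?addr0 // => u /andP[LNu ne].
    by rewrite uA ?(negPf ne) ?mulr0 //; apply: irrLN.
  rewrite (eq_gring_fun A thm) gring_fun_lincomb mt.
  have dthm : {in N, brauer_dual th =1
      fun x => \sum_(u <- LN) m (brauer_dual u) * (u : {ffun gT -> F}) x}.
    move=> x Nx; rewrite ffunE thm ?groupV //.
    rewrite -(perm_big _ (perm_map_inj_stable ULN inj_dual LN_dual)) big_map.
    by apply: eq_bigr => u _; rewrite [in LHS]ffunE invgK.
  by rewrite (eq_gring_fun A dthm) gring_fun_lincomb mt -conj_t m_conj.
(* The coefficient of [t] in [f] on [N] is computed twice: from the expansion of [f] over [G] and
   from the orbit sum. *)
have sum1 : \sum_(th <- L) c th * gring_fun th A = 1.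
  have fcN : {in N, f =1 fun x => \sum_(th <- L) c th * (th : {ffun gT -> F}) x}.
    by move=> x Nx; apply: fc; apply: (subsetP sNG).
  rewrite -gring_fun_lincomb -(eq_gring_fun A fcN).
  have fO : {in N, f =1 fun x => \sum_(u <- O) 1 * (u : {ffun gT -> F}) x}.
    by move=> x Nx; rewrite f_restr //; apply: eq_bigr => u _; rewrite mul1r.
  rewrite (eq_gring_fun A fO) gring_fun_lincomb (bigD1_seq t) ?undup_uniq //=; last first.
    by apply/memO; exists 1%g; rewrite ?brauer_conj1.
  rewrite tA mulr1 big_seq_cond big1 ?addr0 // => u /andP[Ou ne].
  by rewrite uA ?(negPf ne) ?mulr0 //; apply: irrO.
(* Otherwise the self-dual terms vanish and the dual pairs cancel, against [sum1]. *)
have [theta [Lth sd_th nz_th]] : exists theta,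
    [/\ theta \in L, brauer_dual theta == theta & gring_fun theta A != 0].
  apply: NNPP => no_th; have /eqP := oner_neq0 F; apply.
  rewrite -sum1 (sum_involution_pchar2 (addrr_pchar2 ch2) UL L_dual).
  - rewrite big_seq_cond big1 // => th /andP[Lth sd_th].
    have [->|nz] := eqVneq (gring_fun th A) 0; first by rewrite mulr0.
    by case: no_th; exists th.
  - by move=> th _; apply: brauer_dualK.
  by move=> th Lth; rewrite c_dual ?m_dual.
exists theta, A; split=> //; [exact: irrL | exact/eqP |].
by move=> u irr_u ne; rewrite uA // (negPf ne).
Qed.

Lemma self_dual_odd_multiplicity : exists (theta : {ffun gT -> R}) (m : nat),
  [/\ irr_brauer red G theta, theta = brauer_dual theta,
      brauer_multiplicity red N phi (brauer_res N theta) m & odd m].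
Proof.
have [th [A [irr_th sd_th nz_th tA uA]]] := self_dual_trace_over.
have [theta irr_theta def_th] := irr_trace_lift ms splitK (subxx G) irr_th.
have [chi [X [irr_chi sXG res_X]]] := brauer_Clifford ms splitK nsNG irr_theta.
pose s := [seq brauer_conj x chi | x <- enum X].
have irr_s psi : psi \in s -> irr_brauer red N psi.
  case/mapP=> x; rewrite mem_enum => Xx ->.
  by apply: (irr_brauer_conj splitF sNG) => //; apply/nNG/(subsetP sXG).
have res_s : brauer_res N theta = \sum_(psi <- s) psi by rewrite big_map big_enum.
exists theta, (count_mem phi s); split=> //; last 2 first.
- by exists s.
- apply: contraNT nz_th => even_m.
  (* On [N] the trace function is the sum of those of the Clifford constituents, so evaluation at
     [A] counts the occurrences of [phi] modulo 2. *)
  have thE : {in N, th =1 fun x => \sum_(psi <- s) 1 * brauer_trace red N psi x}.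
    move=> x Nx; rewrite -def_th ffunE (subsetP sNG) //.
    have -> : theta (oddpart x) = brauer_res N theta (oddpart x) by rewrite ffunE groupX.
    rewrite res_s sum_ffunE rmorph_sum; apply: eq_bigr => psi _.
    by rewrite ffunE Nx mul1r.
  rewrite (eq_gring_fun A thE) gring_fun_lincomb.
  rewrite (eq_big_seq (fun psi => (psi == phi)%:R)) => [|psi /irr_s irr_psi]; last first.
    rewrite mul1r; have [->//|ne] := eqVneq psi phi.
    rewrite uA //; first exact: (brauer_trace_irr ms irr_psi).
    apply: contra_neq ne.
    exact: (brauer_trace_inj ms splitK splitF sNG).
  have -> : \sum_(psi <- s) (psi == phi)%:R = (count_mem phi s)%:R :> F.
    by rewrite -sum1_count natr_sum [RHS]big_mkcond; 
    apply: eq_bigr => psi _ /=; case: (psi == phi).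
  by rewrite (natr_odd_pchar2 _ ch2) (negPf even_m).
(* Self-duality passes from the trace function back to [theta], as reduction is injective on
   irreducible Brauer characters. *)
apply: (brauer_trace_inj ms splitK splitF (subxx G) irr_theta).
  exact: (irr_brauer_dual splitF (subxx G)).
by rewrite brauer_trace_dual def_th sd_th.
Qed.

End SelfDual.
End Brauer.

Theorem theorem1 (R : idomainType) (K F : fieldType)
    (iota : {rmorphism R -> K}) (red : {rmorphism R -> F})
    (gT : finGroupType) (G N : {group gT}) (phi : {ffun gT -> R}) :
  modular_system 2 iota red ->
  splitting_for_subgroups K G ->
  splitting_for_subgroups F G ->
  (N <| G)%g ->
  irr_brauer red N phi ->
  ((exists theta : {ffun gT -> R},
      [/\ irr_brauer red G theta,
          theta = brauer_dual theta &
          brauer_constituent red N phi (brauer_res N theta)])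
   <-> (exists2 x : gT, x \in G & brauer_conj x phi = brauer_dual phi))
  /\
  ((exists theta : {ffun gT -> R},
      [/\ irr_brauer red G theta,
          theta = brauer_dual theta &
          brauer_constituent red N phi (brauer_res N theta)]) ->
   exists (theta : {ffun gT -> R}) (m : nat),
     [/\ irr_brauer red G theta,
         theta = brauer_dual theta,
         brauer_multiplicity red N phi (brauer_res N theta) m &
         odd m]).
Proof.
move=> ms splitK splitF nsNG irr_phi.
have fwd : (exists theta : {ffun gT -> R},
      [/\ irr_brauer red G theta, theta = brauer_dual theta &
          brauer_constituent red N phi (brauer_res N theta)]) ->
    exists2 x : gT, x \in G & brauer_conj x phi = brauer_dual phi.
  by case=> theta [irr_th sd_th const];
    apply: (conjugate_dual_of_self_dual ms splitK splitF nsNG irr_th).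
(* The converse comes directly with odd, hence positive, multiplicity; preceded by [fwd] it also
   gives the last claim. *)
have bwd x : x \in G -> brauer_conj x phi = brauer_dual phi -> _ :=
  self_dual_odd_multiplicity ms splitK splitF nsNG irr_phi (y := x).
split; last by case/fwd=> x; apply: bwd.
split=> // -[x Gx conj_x]; have [theta [m [irr_th sd_th mult odd_m]]] := bwd x Gx conj_x.
by exists theta; split=> //; exists m; first exact: odd_gt0.
Qed.
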